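(* Let $a>0$, $\lambda\in\mathbb{R}$, let $(\gamma_n)_{n\ge0}$ be i.i.d. with law $GIG(\lambda,a,a)$, and for $n\ge1$ let $$X_n=\prod_{i=0}^{n-1}\gamma_i,\qquad Z_n=\sum_{k=0}^{n-1}\Big(\prod_{i=0}^{k-1}\gamma_i^{-1}\Big)\Big(\prod_{j=k+1}^{n-1}\gamma_j\Big).$$ Let $P$ and $Q$ be the transition kernels on $(0,+\infty)$ of the Markov chains $(X_n)_{n\ge1}$ and $(Z_n)_{n\ge 1}$: $$P(x,dy)=\frac{1}{2K_\lambda(a^2)}\frac{y^{\lambda-1}}{x^\lambda}e^{-\frac{a^2}{2}\left(\frac yx+\frac xy\right)}\mathbf{1}_{(0,+\infty)}(y)\,dy,$$ $$Q(x,dy)=\frac{1}{2K_\lambda(a^2)}\,\frac{K_\lambda\left(\frac{a^2}{y}\right)}{K_\lambda\left(\frac{a^2}{x}\right)}\,\frac1y\,e^{-\frac{a^2(x^2+y^2+1)}{2xy}}\,\mathbf{1}_{(0,+\infty)}(y)\,dy.$$ Then $P$ and $Q$ are intertwined by the Markov kernel $\Lambda$ given by the conditional law of $X_n$ given $Z_n$, which does not depend on $n$: the conditional law of $X_n$ given $Z_n=z$ is, for every $n\geq 1$, $$\Lambda(z,dx)=\frac{1}{2K_\lambda\left(\frac{a^2}{z}\right)}x^{\lambda-1}e^{-\frac{a^2}{2z}\left(x+\frac1x\right)}\mathbf{1}_{(0,+\infty)}(x)\,dx\qquad (z>0),$$ and $$\Lambda P=Q\Lambda.$$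
   Context: Empty products equal $1$. For $a>0$ and $\lambda\in\mathbb{R}$, $GIG(\lambda,a,a)$ (Generalized Inverse Gaussian) is the probability law on $(0,+\infty)$ with density $x\mapsto \frac{1}{2K_\lambda(a^2)}x^{\lambda-1}e^{-\frac{a^2}{2}(x+\frac1x)}$, where $K_\lambda(z)=\frac12\int_0^{+\infty}x^{\lambda-1}e^{-\frac z2(x+\frac1x)}dx$ for $z>0$ is the Macdonald function. Composition of kernels is defined by $\Lambda P(u,dv)=\int P(y,dv)\,\Lambda(u,dy)$; a Markov kernel $\Lambda$ intertwines $P$ and $Q$ if $\Lambda P=Q\Lambda$. *)

(* Defs.v *)
From HB Require Import structures.
From mathcomp Require Import all_boot all_order all_algebra.
From mathcomp Require Import all_classical all_reals all_analysis.
From mathcomp Require Import measurable_realfun.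

Set Implicit Arguments.
Unset Strict Implicit.
Unset Printing Implicit Defensive.

Import Order.TTheory GRing.Theory Num.Theory.
Import numFieldNormedType.Exports.

Local Open Scope classical_set_scope.
Local Open Scope ring_scope.

Notation posreals R := (`]0%R, +oo[%classic : set R).

Lemma measurable_invr (R : realType) :
  measurable_fun [set: R] (fun x : R => x^-1).
Proof.
rewrite -(setvU [set (0 : R)]).
apply/measurable_funU => //; first exact: measurableC.
split; last first.
  exact: measurable_fun_set1.
apply: open_continuous_measurable_fun.
  by apply: closed_openC; exact: closed_eq.
move=> x; rewrite inE/= => /eqP x0; exact: inv_continuous.
Qed.

Lemma measurable_fun_invr d (T : measurableType d) (R : realType)
    (D : set T) (f : T -> R) :
  measurable_fun D f -> measurable_fun D (fun x => (f x)^-1).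
Proof. by move=> mf; exact: (measurableT_comp (@measurable_invr R)). Qed.

Lemma measurable_fun_divr d (T : measurableType d) (R : realType)
    (D : set T) (f g : T -> R) :
  measurable_fun D f -> measurable_fun D g ->
  measurable_fun D (fun x => f x / g x).
Proof. by move=> mf mg; apply: measurable_funM => //; exact: measurable_fun_invr. Qed.

(** Macdonald function; the integral is finite for [0 < z]. *)
Definition macdonald (R : realType) (lam z : R) : R :=
  2^-1 * \int[lebesgue_measure]_(x in posreals R)
           (x `^ (lam - 1) * expR (- (z / 2) * (x + x^-1))).

Lemma macdonald_ge0 (R : realType) (lam z : R) : 0 <= macdonald lam z.
Proof.
rewrite mulr_ge0// /Rintegral fine_ge0//; apply: integral_ge0 => x _.
by rewrite lee_fin mulr_ge0// ?powR_ge0// expR_ge0.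
Qed.

Lemma measurable_macdonald (R : realType) (lam : R) :
  measurable_fun [set: R] (macdonald lam).
Proof.
apply: measurable_funM => //.
rewrite /Rintegral; apply: measurableT_comp => //.
pose g (p : R * R) : \bar R :=
  (if 0 < p.2 then p.2 `^ (lam - 1) * expR (- (p.1 / 2) * (p.2 + p.2^-1))
   else 0)%:E.
have mg : measurable_fun [set: R * R] g.
  apply/measurable_EFinP; apply: measurable_fun_ifT => //.
    exact: measurable_fun_ltr.
  apply: measurable_funM.
    exact: (measurableT_comp (measurable_powR _)).
  apply: measurableT_comp => //; apply: measurable_funM.
    by apply: measurableT_comp => //; exact: measurable_funM.
  by apply: measurable_funD => //; exact: measurable_fun_invr.
have g0 p : (0 <= g p)%E.
  by rewrite lee_fin; case: ifP => // _; rewrite mulr_ge0// ?powR_ge0// expR_ge0.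
have := measurable_fun_fubini_tonelli_F
  (T1 := measurableTypeR R)
  (T2 := measurableTypeR R) (m2 := lebesgue_measure) g mg g0.
congr (measurable_fun _ _); apply/funext => z.
rewrite [RHS]integral_mkcond; apply: eq_integral => x _.
by rewrite /g patchE/= mem_setE in_itv/= andbT; case: ifP.
Qed.

(** The law GIG(lam, a, a). *)
Definition gig_law (R : realType) (lam a : R) (A : set R) : \bar R :=
  \int[lebesgue_measure]_(x in A `&` posreals R)
    ((2 * macdonald lam (a ^+ 2))^-1 * x `^ (lam - 1) *
     expR (- (a ^+ 2 / 2) * (x + x^-1)))%:E.

(** [density_kernel f0 mf] is the kernel [f x y 1_(0,+oo)(y) dy]. *)
Section density_kernel.
Context (R : realType) (f : R -> R -> R).

Definition density_kernel of (forall x y, 0 < y -> 0 <= f x y)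
    & measurable_fun [set: R * R] (fun p => f p.1 p.2) :=
  fun (x : R) (A : set R) =>
    (\int[lebesgue_measure]_(y in A `&` posreals R) (f x y)%:E)%E.

Hypothesis f0 : forall x y, 0 < y -> 0 <= f x y.
Hypothesis mf : measurable_fun [set: R * R] (fun p => f p.1 p.2).

Let mfx x : measurable_fun [set: R] (fun y => (f x y)%:E).
Proof.
apply/measurable_EFinP.
exact: (measurableT_comp mf (measurable_pair1 x)).
Qed.

Let fr x := (fun y => (f x y)%:E) \_ (posreals R).

Let fr0 x y : (0 <= fr x y)%E.
Proof.
rewrite /fr patchE mem_setE in_itv/= andbT.
by case: ifPn => // y0; rewrite lee_fin f0.
Qed.

Let mfr x : measurable_fun [set: R] (fr x).
Proof. by apply/measurable_restrict => //; exact: measurable_funTS. Qed.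

Let kE x : density_kernel f0 mf x =
  fun A => (\int[lebesgue_measure]_(y in A) fr x y)%E.
Proof. by apply/funext => A; exact: integral_mkcondr. Qed.

Let k0 x : density_kernel f0 mf x set0 = 0%E.
Proof. by rewrite kE integral_set0. Qed.

Let k_ge0 x A : (0 <= density_kernel f0 mf x A)%E.
Proof. by rewrite kE; exact: integral_ge0. Qed.

Let k_sigma x : semi_sigma_additive (density_kernel f0 mf x).
Proof. rewrite kE.
exact: (@semi_sigma_additive_nng_induced _ (measurableTypeR R) R lebesgue_measure (fr x) (mfr x) (fr0 x)). Qed.

HB.instance Definition _ x := isMeasure.Build _ _ _
  (density_kernel f0 mf x) (k0 x) (k_ge0 x) (@k_sigma x).

Definition density_mkernel : R -> {measure set R -> \bar R} :=
  density_kernel f0 mf.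

Let mk U : measurable U ->
  measurable_fun [set: R] (density_mkernel ^~ U).
Proof.
move=> mU.
pose D := [set: R] `*` (U `&` posreals R).
have mD : measurable D by apply: measurableX => //; exact: measurableI.
pose g := (fun p : R * R => (f p.1 p.2)%:E) \_ D.
have mg : measurable_fun [set: R * R] g.
  by apply/measurable_restrict => //; apply: measurable_funTS;
    exact/measurable_EFinP.
have g0 p : (0 <= g p)%E.
  rewrite /g patchE; case: ifPn => //; rewrite inE/= => -[_ [_]].
  by rewrite /= in_itv/= andbT => p0; rewrite lee_fin f0.
have := measurable_fun_fubini_tonelli_F
  (T1 := measurableTypeR R)
  (T2 := measurableTypeR R) (m2 := lebesgue_measure) g mg g0.
congr (measurable_fun _ _); apply/funext => x.
rewrite /density_mkernel/= /density_kernel [RHS]integral_mkcond.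
apply: eq_integral => y _; rewrite /g !patchE.
by congr (if _ then _ else _); apply/idP/idP; rewrite !inE /D/=; tauto.
Qed.

HB.instance Definition _ := isKernel.Build _ _ R R R density_mkernel mk.

End density_kernel.

(** The kernels below are meaningful at points [x > 0] only; elsewhere their
    values are irrelevant. *)
Section kernels.
Context (R : realType) (a lam : R).

Definition P_density (x y : R) : R :=
  (2 * macdonald lam (a ^+ 2))^-1 * (y `^ (lam - 1) / x `^ lam) *
  expR (- (a ^+ 2 / 2) * (y / x + x / y)).

Definition Q_density (x y : R) : R :=
  (2 * macdonald lam (a ^+ 2))^-1 *
  (macdonald lam (a ^+ 2 / y) / macdonald lam (a ^+ 2 / x)) * y^-1 *
  expR (- (a ^+ 2 * (x ^+ 2 + y ^+ 2 + 1) / (2 * x * y))).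

Definition Lambda_density (z x : R) : R :=
  (2 * macdonald lam (a ^+ 2 / z))^-1 * x `^ (lam - 1) *
  expR (- (a ^+ 2 / (2 * z)) * (x + x^-1)).

Lemma P_density_ge0 x y : 0 < y -> 0 <= P_density x y.
Proof.
have K0 z : 0 <= macdonald lam z by exact: macdonald_ge0.
rewrite /P_density; move: (macdonald lam) K0 => K K0 _.
by rewrite !mulr_ge0 ?expR_ge0 ?invr_ge0 ?mulr_ge0 ?powR_ge0.
Qed.

Lemma Q_density_ge0 x y : 0 < y -> 0 <= Q_density x y.
Proof.
have K0 z : 0 <= macdonald lam z by exact: macdonald_ge0.
rewrite /Q_density; move: (macdonald lam) K0 => K K0 /ltW y0.
by rewrite !mulr_ge0 ?expR_ge0 ?invr_ge0 ?mulr_ge0.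
Qed.

Lemma Lambda_density_ge0 z x : 0 < x -> 0 <= Lambda_density z x.
Proof.
have K0 u : 0 <= macdonald lam u by exact: macdonald_ge0.
rewrite /Lambda_density; move: (macdonald lam) K0 => K K0 _.
by rewrite !mulr_ge0 ?expR_ge0 ?invr_ge0 ?mulr_ge0 ?powR_ge0.
Qed.

Lemma measurable_P_density :
  measurable_fun [set: R * R] (fun p => P_density p.1 p.2).
Proof.
apply: measurable_funM; first apply: measurable_funM => //.
  by apply: measurable_fun_divr; exact: (measurableT_comp (measurable_powR _)).
apply: measurableT_comp => //; apply: measurable_funM => //.
by apply: measurable_funD; exact: measurable_fun_divr.
Qed.

Let mK (h : R * R -> R) : measurable_fun [set: R * R] h ->
  measurable_fun [set: R * R] (fun p => macdonald lam (a ^+ 2 / h p)).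
Proof.
move=> mh; apply: (measurableT_comp (measurable_macdonald lam)).
exact: measurable_fun_divr.
Qed.

Lemma measurable_Q_density :
  measurable_fun [set: R * R] (fun p => Q_density p.1 p.2).
Proof.
apply: measurable_funM; first apply: measurable_funM => //.
- by apply: measurable_funM => //; apply: measurable_fun_divr; exact: mK.
- exact: measurable_fun_invr.
- apply: measurableT_comp => //; apply: measurableT_comp => //.
  apply: measurable_fun_divr; apply: measurable_funM => //.
  + by apply: measurable_funD => //; apply: measurable_funD;
      exact: measurable_funX.
  + exact: measurable_funM.
Qed.

Lemma measurable_Lambda_density :
  measurable_fun [set: R * R] (fun p => Lambda_density p.1 p.2).
Proof.
apply: measurable_funM; first apply: measurable_funM.
- by apply: measurable_fun_invr; apply: measurable_funM => //; exact: mK.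
- exact: (measurableT_comp (measurable_powR _)).
- apply: measurableT_comp => //; apply: measurable_funM.
    apply: measurableT_comp => //; apply: measurable_fun_divr => //.
    exact: measurable_funM.
  by apply: measurable_funD => //; exact: measurable_fun_invr.
Qed.

Definition kernelP : R.-ker R ~> R :=
  density_mkernel P_density_ge0 measurable_P_density.

Definition kernelQ : R.-ker R ~> R :=
  density_mkernel Q_density_ge0 measurable_Q_density.

Definition kernelLambda : R.-ker R ~> R :=
  density_mkernel Lambda_density_ge0 measurable_Lambda_density.

End kernels.

Section processes.
Context d (T : measurableType d) (R : realType) (Pr : probability T R).
Variable gam : nat -> {RV Pr >-> R}.

Definition procX (n : nat) (w : T) : R := \prod_(0 <= i < n) gam i w.

Definition procZ (n : nat) (w : T) : R :=
  \sum_(0 <= k < n)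
    (\prod_(0 <= i < k) (gam i w)^-1) * (\prod_(k.+1 <= j < n) gam j w).

Lemma measurable_procX n : measurable_fun [set: T] (procX n).
Proof. by apply: measurable_prod => i _. Qed.

Lemma measurable_procZ n : measurable_fun [set: T] (procZ n).
Proof.
apply: measurable_sum => k; apply: measurable_funM.
  by apply: measurable_prod => i _; exact: measurable_fun_invr.
by apply: measurable_prod => i _.
Qed.

HB.instance Definition _ n :=
  isMeasurableFun.Build _ _ _ _ (procX n) (measurable_procX n).
HB.instance Definition _ n :=
  isMeasurableFun.Build _ _ _ _ (procZ n) (measurable_procZ n).

Definition rvX (n : nat) : {RV Pr >-> R} := procX n.
Definition rvZ (n : nat) : {RV Pr >-> R} := procZ n.

End processes.

Section probability_notions.
Context d (T : measurableType d) (R : realType) (Pr : probability T R).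

Definition mutually_independent (X : nat -> {RV Pr >-> R}) :=
  forall (s : seq nat) (B : nat -> set R), uniq s ->
    (forall i, measurable (B i)) ->
    Pr (\bigcap_(i in [set` s]) X i @^-1` B i) =
    (\prod_(i <- s) Pr (X i @^-1` B i))%E.

(** Generators of the sigma-algebra [sigma(X_k, k in J)]. *)
Definition generators (J : set nat) (X : nat -> {RV Pr >-> R}) :
    set_system T :=
  \bigcup_(k in J) preimage_set_system setT (X k) measurable.

(** [kappa] is a regular conditional law of [Y] given the sigma-algebra
    [<<s G >>]. *)
Definition conditional_law (G : set_system T) (Y : {RV Pr >-> R})
    (kappa : T -> {measure set R -> \bar R}) :=
  forall B : set R, measurable B ->
    measurable_fun [set: g_sigma_algebraType G] (fun w => kappa w B) /\
    forall A : set T, <<s G >> A ->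
      Pr (A `&` Y @^-1` B) = (\int[Pr]_(w in A) kappa w B)%E.

(** A kernel on [R] whose restriction to the state space [S] is Markov. *)
Definition markov_kernel_on (S : set R) (k : R.-ker R ~> R) :=
  forall x, S x -> k x S = 1%E /\ k x (~` S) = 0%E.

(** [(X_n)_{n >= 1}] is a Markov chain on [S] with transition kernel [k], with
    respect to its own filtration. *)
Definition markov_chain_on (S : set R) (X : nat -> {RV Pr >-> R})
    (k : R.-ker R ~> R) :=
  [/\ markov_kernel_on S k,
      forall n, (1 <= n)%N -> {ae Pr, forall w, S (X n w)} &
      forall n, (1 <= n)%N ->
        conditional_law (generators [set i | (1 <= i <= n)%N] X)
          (X n.+1) (fun w => k (X n w))].

End probability_notions.

(** The Markov kernel [L] on [S] intertwines [P] and [Q]: [L P = Q L] on [S]. *)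
Definition intertwines (R : realType) (S : set R) (L P Q : R.-ker R ~> R) :=
  markov_kernel_on S L /\
  forall u, S u -> forall A : set R, measurable A ->
    kcomp_noparam L P u A = kcomp_noparam Q L u A.

(* Main.v *)
Require Import Defs.
From HB Require Import structures.
From mathcomp Require Import all_boot all_order all_algebra.
From mathcomp Require Import all_classical all_reals all_analysis.
From mathcomp Require Import measurable_realfun ring lra.

(** A step of the chains is [X' = X g], [Z' = Z g + 1/X] with [g] distributed as
    [GIG(lam, a, a) = Lambda(1, .)] and independent of the past. If [X] has law
    [Lambda(z, .)] and [Z = z], the successive scalings [x = t / g] and
    [g = y t / (z t + 1)] of the measure [dx / x] show that [(Z', X')] has law
    [Q(z, dy) Lambda(y, dt)]. Its marginals say that [Q] is Markov and that
    [Lambda P = Q Lambda]; and it propagates, from [n] to [n + 1], the statement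
    that [X_n] has conditional law [Lambda(Z_n, .)] given [Z_1, ..., Z_n]. *)

Set Implicit Arguments.
Unset Strict Implicit.
Unset Printing Implicit Defensive.

Import Order.TTheory GRing.Theory Num.Theory.
Import numFieldNormedType.Exports.
Local Open Scope classical_set_scope.
Local Open Scope ring_scope.

(** * Measures with densities *)

(** All computations are tested on nonnegative, possibly infinite functions [F] of a pair, so that
    Tonelli applies without integrability conditions; the one integral to be proved finite is the
    Macdonald integral, which [fine] would otherwise turn into 0. The measure dx / x is preferred to
    dx because each change of variables is a scaling once the other variable is frozen, so that no
    Jacobian of two variables appears. Two gaps separate the kernel identity from the chains. The
    kernels are defined on all of [R] but behave well only at positive points, and the chains are
    positive only almost surely; equalities are therefore compared on y > 0 under a kernel, and
    almost everywhere under [Pr]. Moreover, conditional laws are given on events, whereas a step of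
    the chain involves a function of the past and of one further variable. A disintegration formula,
    extended from rectangles, bridges this gap and serves twice in each step: to integrate out
    [gam n] given the earlier [gam i], then [X_n] given [Z_1, ..., Z_n]. *)

Section integral_density.
Context d (T : measurableType d) (R : realType).
Variables (mu nu : {measure set T -> \bar R}) (h : T -> R).
Hypothesis mh : measurable_fun [set: T] h.
Hypothesis h0 : forall x, 0 <= h x.
Hypothesis nuE : forall A, measurable A -> nu A = (\int[mu]_(x in A) (h x)%:E)%E.

Import HBNNSimple.

Let integral_density_nnsfun (f : {nnsfun T >-> R}) :
  (\int[nu]_x (f x)%:E = \int[mu]_x ((h x)%:E * (f x)%:E))%E.
Proof.
under [LHS]eq_integral do rewrite fimfunE -fsumEFin//.
rewrite [LHS]ge0_integral_fsum//; last 2 first.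
  - by move=> r; exact/measurable_EFinP/measurableT_comp.
  - by move=> n x _; rewrite EFinM nnfun_muleindic_ge0.
under [RHS]eq_integral.
  move=> x xD; rewrite fimfunE -fsumEFin// ge0_mule_fsumr; last first.
    by move=> r; rewrite EFinM nnfun_muleindic_ge0.
  over.
rewrite [RHS]ge0_integral_fsum//; last 2 first.
  - move=> r; apply: emeasurable_funM => //; first exact/measurable_EFinP.
    by apply/measurable_EFinP; exact: measurableT_comp.
  - move=> r x _; apply: mule_ge0; first by rewrite lee_fin.
    by rewrite EFinM nnfun_muleindic_ge0.
apply: eq_fsbigr => r _.
have mr : measurable (f @^-1` [set r]) by exact: measurable_sfunP.
under [RHS]eq_integral do rewrite EFinM muleCA.
(* A nonnegative simple function never takes a value [r < 0]: both terms vanish. *)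
have [r0|r0] := leP 0 r; last first.
  rewrite preimage_nnfun0// !integral0_eq// => x _; rewrite indic0/=.
    by rewrite mule0 mule0.
  by rewrite mulr0.
rewrite [RHS]ge0_integralZl//; last 2 first.
  - by apply: emeasurable_funM => //; exact/measurable_EFinP.
  - by move=> x _; rewrite mule_ge0// lee_fin.
rewrite integralZl_indic_nnsfun// integral_indic// setIT.
congr (_ * _)%E; rewrite nuE// integral_mkcond.
apply: eq_integral => x _; rewrite patchE indicE.
by case: ifPn; rewrite ?mule1 ?mule0.
Qed.

Lemma integral_density (f : T -> \bar R) :
  measurable_fun [set: T] f -> (forall x, 0 <= f x)%E ->
  (\int[nu]_x f x = \int[mu]_x ((h x)%:E * f x))%E.
Proof.
move=> mf f0; pose f_ := nnsfun_approx measurableT mf.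
transitivity (limn (fun n => \int[nu]_x (f_ n x)%:E))%E.
  rewrite -monotone_convergence//=.
  - apply: eq_integral => x /[!inE] xD; apply/esym/cvg_lim => //=.
    exact: cvg_nnsfun_approx.
  - by move=> n; apply: measurableT_comp => //; exact: measurable_funTS.
  - by move=> n x _; rewrite lee_fin.
  - by move=> x _ a b ab; rewrite lee_fin//; exact/lefP/nd_nnsfun_approx.
under eq_fun do rewrite integral_density_nnsfun.
rewrite -monotone_convergence//=.
- apply: eq_integral => x _; apply/cvg_lim => //.
  by apply: cvgeZl => //; exact: cvg_nnsfun_approx.
- move=> n; apply: emeasurable_funM => //; first exact/measurable_EFinP.
  by apply: measurableT_comp => //; exact: measurable_funTS.
- by move=> n x _; rewrite mule_ge0// lee_fin.
- move=> x _ a b ab; apply: lee_wpmul2l; first by rewrite lee_fin.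
  by rewrite lee_fin//; exact/lefP/nd_nnsfun_approx.
Qed.
End integral_density.

(** * Integration against dx / x on the positive half-line *)

Section lebesgue_scale.
Context (R : realType).
Notation mu := (@lebesgue_measure R).

(** The rescaled image measure gives []a, b]] its length, and this characterises Lebesgue
    measure. *)
Lemma lebesgue_measure_scale (c : R) (A : set R) : 0 < c -> measurable A ->
  (c%:E * pushforward mu ( *%R c : _ -> measurableTypeR R) A = mu A)%E.
Proof.
move=> c0 mA.
have mphi : measurable_fun [set: measurableTypeR R]
    ( *%R c : measurableTypeR R -> measurableTypeR R).
  exact: (@measurable_funM _ R).
apply/esym/(@lebesgue_measure_unique R (mscale (NngNum (ltW c0))
  (measure_function_pushforward__canonical__measure_function_Measure mu mphi))) =>
  //= _ [[a b]] _ <-.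
rewrite /mscale/= /pushforward.
have -> : *%R c @^-1` `]a, b] = `]c^-1 * a, c^-1 * b]%classic.
  by apply/seteqP; split => x /=; rewrite !in_itv/= ler_pdivlMl// ltr_pdivrMl.
rewrite !lebesgue_measure_itv/= !lte_fin ltr_pM2l ?invr_gt0//.
case: ifPn => ab; last by rewrite mule0.
by rewrite -!EFinB -EFinM -mulrBr mulVKf ?gt_eqF.
Qed.

Lemma ge0_integral_scale (c : R) (f : R -> \bar R) : 0 < c ->
  measurable_fun [set: R] f -> (forall x, 0 <= f x)%E ->
  (\int[mu]_x f x = c%:E * \int[mu]_x f (c * x)%R)%E.
Proof.
move=> c0 mf f0.
have mphi : measurable_fun [set: measurableTypeR R]
    ( *%R c : measurableTypeR R -> measurableTypeR R).
  exact: (@measurable_funM _ R).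
rewrite -(@ge0_integral_pushforward _ _ _ _ R _ mphi mu setT f)//.
rewrite -(@ge0_integral_mscale _ (measurableTypeR R) R _ _ measurableT
  (NngNum (ltW c0)))//.
apply: eq_measure_integral => A mA _; exact/esym/lebesgue_measure_scale.
Qed.
End lebesgue_scale.

Section haar.
Context (R : realType).
Notation mu := (@lebesgue_measure R).
Implicit Types f : R -> \bar R.

(** Integral against the Haar measure dx / x of the multiplicative group of positive reals. The
    weight is cut to 0 elsewhere, so that the integral runs over the whole line and scalings need no
    change of domain. *)
Definition haar f : \bar R :=
  (\int[mu]_x ((if 0 < x then x^-1 else 0)%:E * f x))%E.

Lemma haar_weight_ge0 (x : R) : (0 <= (if 0 < x then x^-1 else 0)%:E)%E.
Proof. by rewrite lee_fin; case: ifPn => // x0; rewrite invr_ge0 ltW. Qed.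

Lemma measurable_haar_weight :
  measurable_fun [set: R] (fun x : R => (if 0 < x then x^-1 else 0)).
Proof.
apply: measurable_fun_ifT => //; first exact: measurable_fun_ltr.
exact: measurable_invr.
Qed.

Let w0 := haar_weight_ge0.
Let mw := measurable_haar_weight.

Lemma eq_haar f g : (forall x, 0 < x -> f x = g x) -> haar f = haar g.
Proof.
move=> fg; apply: eq_integral => x _; case: ifPn => [x0|]; first by rewrite fg.
by rewrite !mul0e.
Qed.

Lemma haar_ge0 f : (forall x, 0 <= f x)%E -> (0 <= haar f)%E.
Proof. by move=> f0; apply: integral_ge0 => x _; exact: mule_ge0. Qed.

Lemma haarZl (k : R) f : 0 <= k -> measurable_fun [set: R] f ->
  (forall x, 0 <= f x)%E -> haar (fun x => k%:E * f x)%E = (k%:E * haar f)%E.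
Proof.
move=> k0 mf f0; rewrite /haar -ge0_integralZl//.
- by apply: eq_integral => x _; rewrite muleCA.
- by apply: emeasurable_funM => //; exact/measurable_EFinP.
- by move=> x _; exact: mule_ge0.
Qed.

(** The factor [c] from Lebesgue measure cancels the one in 1 / (c x), and [c > 0] preserves the cut
    at 0. *)
Lemma haar_scale (c : R) f : 0 < c -> measurable_fun [set: R] f ->
  (forall x, 0 <= f x)%E -> haar (fun x => f (c * x)) = haar f.
Proof.
move=> c0 mf f0; rewrite {2}/haar (ge0_integral_scale c0); last 2 first.
- by apply: emeasurable_funM => //; exact/measurable_EFinP.
- by move=> x; exact: mule_ge0.
rewrite -ge0_integralZl//; last 3 first.
- apply: emeasurable_funM.
    apply/measurable_EFinP; apply: (measurableT_comp measurable_haar_weight).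
    exact: measurable_funM.
  by apply: (measurableT_comp mf); exact: measurable_funM.
- by move=> x _; exact: mule_ge0.
- exact: ltW.
apply: eq_integral => x _; rewrite muleA -EFinM pmulr_rgt0//.
by congr (_%:E * _)%E; case: ifPn => _; rewrite ?mulr0// invfM mulVKf ?gt_eqF.
Qed.

Section prod.
Context d (S : measurableType d).
Variable f : S * R -> \bar R.
Hypotheses (mf : measurable_fun [set: S * R] f) (f0 : forall p, (0 <= f p)%E).

Let g (p : S * R) := ((if 0 < p.2 then p.2^-1 else 0)%:E * f p)%E.

Let mg : measurable_fun [set: S * R] g.
Proof.
apply: emeasurable_funM => //; apply/measurable_EFinP.
exact: (measurableT_comp measurable_haar_weight).
Qed.

Let g0 p : (0 <= g p)%E. Proof. exact: mule_ge0. Qed.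

Lemma measurable_haar : measurable_fun [set: S] (fun s => haar (fun x => f (s, x))).
Proof.
exact: (@measurable_fun_fubini_tonelli_F _ _ S (measurableTypeR R) R mu g mg g0).
Qed.

Lemma integral_haar (m : {sigma_finite_measure set S -> \bar R}) :
  (\int[m]_s haar (fun x => f (s, x)) = haar (fun x => \int[m]_s f (s, x)))%E.
Proof.
rewrite (@fubini_tonelli _ _ S (measurableTypeR R) R m mu g mg g0).
apply: eq_integral => x _.
rewrite /fubini_G /g/= ge0_integralZl//.
exact: measurableT_comp.
Qed.
End prod.

Lemma haarC (f : R * R -> \bar R) : measurable_fun [set: R * R] f ->
  (forall p, 0 <= f p)%E ->
  haar (fun x => haar (fun y => f (x, y))) = haar (fun y => haar (fun x => f (x, y))).
Proof.
move=> mf f0.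
pose g (p : R * R) := ((if 0 < p.1 then p.1^-1 else 0)%:E * f p)%E.
have g0 p : (0 <= g p)%E by exact: mule_ge0.
have mg : measurable_fun [set: R * R] g.
  apply: emeasurable_funM => //; apply/measurable_EFinP.
  exact: (measurableT_comp measurable_haar_weight).
rewrite -[RHS](@integral_haar _ (measurableTypeR R) g mg g0 mu).
apply: eq_integral => x _; rewrite /haar -ge0_integralZl//.
- by apply: eq_integral => y _; rewrite muleCA.
- apply: emeasurable_funM; first exact/measurable_EFinP.
  exact: measurableT_comp.
- by move=> y _; exact: mule_ge0.
Qed.

Variables (k : R -> R -> R) (k0 : forall x y, 0 < y -> 0 <= k x y).
Hypothesis mk : measurable_fun [set: R * R] (fun p => k p.1 p.2).

(** The factor [y] compensates the weight 1 / y: kernels have densities with respect to dy, while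
    changes of variables are made in dy / y. *)
Lemma integral_density_mkernel x f : measurable_fun [set: R] f ->
  (forall x, 0 <= f x)%E ->
  (\int[density_mkernel k0 mk x]_y f y = haar (fun y => (y * k x y)%:E * f y))%E.
Proof.
move=> mf f0.
(* [R] and [measurableTypeR R], on which [lebesgue_measure] lives, have the same
   measurable sets but distinct displays: the kernel is moved along [id]. *)
pose nu : set (measurableTypeR R) -> \bar R := density_mkernel k0 mk x.
pose nu_measure := isMeasure.Build _ (measurableTypeR R) R nu
  (measure0 (density_mkernel k0 mk x))
  (measure_ge0 (density_mkernel k0 mk x))
  (@measure_semi_sigma_additive _ _ _ (density_mkernel k0 mk x)).
pose nuM : {measure set (measurableTypeR R) -> \bar R} := HB.pack nu nu_measure.
have mid : measurable_fun [set: measurableTypeR R] (id : measurableTypeR R -> R).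
  by move=> _ A mA; rewrite setTI.
transitivity (\int[pushforward nuM (id : measurableTypeR R -> R)]_y f y)%E.
  exact: eq_measure_integral.
rewrite (ge0_integral_pushforward mid)//=.
rewrite (@integral_density _ (measurableTypeR R) R mu nuM
  (fun y => if 0 < y then k x y else 0))//.
- apply: eq_integral => y _; rewrite muleA -EFinM.
  by case: ifPn => y0; rewrite ?mul0r// mulKf ?gt_eqF.
- apply: (@measurable_fun_ifT _ _ R) => //; first exact: measurable_fun_ltr.
  exact: (measurableT_comp mk (measurable_pair1 x)).
- by move=> y; case: ifPn => // y0; exact: k0.
- move=> A mA; rewrite [LHS]integral_mkcondr; apply: eq_integral => y _.
  by rewrite patchE mem_setE in_itv/= andbT; case: ifPn.
Qed.

Lemma measurable_integral_density_mkernel d (S : measurableType d) (u : S -> R)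
    (f : S * R -> \bar R) :
  measurable_fun [set: S] u -> measurable_fun [set: S * R] f ->
  (forall p, 0 <= f p)%E ->
  measurable_fun [set: S] (fun s => \int[density_mkernel k0 mk (u s)]_y f (s, y))%E.
Proof.
move=> mu_ mf f0.
pose g (p : S * R) := ((if 0 < p.2 then p.2 * k (u p.1) p.2 else 0)%:E * f p)%E.
have mg : measurable_fun [set: S * R] g.
  apply: emeasurable_funM => //; apply/measurable_EFinP.
  apply: measurable_fun_ifT => //; first exact: measurable_fun_ltr.
  apply: measurable_funM => //.
  apply: (measurableT_comp (g := fun p : S * R => (u p.1, p.2)) mk).
  by apply: measurable_fun_pair => //; exact: measurableT_comp.
have g0 p : (0 <= g p)%E.
  apply: mule_ge0 => //; rewrite lee_fin; case: ifPn => // p0.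
  by rewrite mulr_ge0 ?k0 ?ltW.
apply: (eq_measurable_fun (fun s => haar (fun y => g (s, y)))); last first.
  exact: measurable_haar.
move=> s _; rewrite integral_density_mkernel//; last first.
  exact: (measurableT_comp mf (measurable_pair1 s)).
by apply: eq_haar => y y0; rewrite /g/= y0.
Qed.

(** A density kernel does not charge the nonpositive points, where the identities between inner
    integrals may fail. *)
Lemma eq_integral_density_mkernel x f g :
  measurable_fun [set: R] f -> measurable_fun [set: R] g ->
  (forall y, 0 <= f y)%E -> (forall y, 0 <= g y)%E ->
  (forall y, 0 < y -> f y = g y) ->
  (\int[density_mkernel k0 mk x]_y f y = \int[density_mkernel k0 mk x]_y g y)%E.
Proof.
move=> mf mg f0 g0 fg; rewrite !integral_density_mkernel//.
by apply: eq_haar => y y0; rewrite fg.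
Qed.

End haar.

(** * The Macdonald function *)

Section macdonald.
Context (R : realType).
Notation mu := (@lebesgue_measure R).
Variable lam : R.

(** Unnormalised density with respect to dx / x, whence the exponent [lam] in place of [lam - 1].
    With [c = a ^+ 2] it gives the GIG law, with [c = a ^+ 2 / z] the kernel Lambda(z, .). *)
Definition gig_weight (c x : R) : R :=
  x `^ lam * expR (- (c / 2) * (x + x^-1)).

Lemma gig_weight_ge0 c x : 0 <= gig_weight c x.
Proof. by rewrite mulr_ge0 ?powR_ge0 ?expR_ge0. Qed.

Lemma measurable_gig_weight d (S : measurableType d) (u v : S -> R) :
  measurable_fun [set: S] u -> measurable_fun [set: S] v ->
  measurable_fun [set: S] (fun s => gig_weight (u s) (v s)).
Proof.
move=> mu mv; apply: measurable_funM.
  exact: (measurableT_comp (measurable_powR _)).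
apply: measurableT_comp => //; apply: measurable_funM.
  by apply: measurableT_comp => //; exact: measurable_funM.
by apply: measurable_funD => //; exact: measurable_fun_invr.
Qed.

Lemma powRB1 (x : R) : 0 < x -> x `^ (lam - 1) = x^-1 * x `^ lam.
Proof.
move=> x0; rewrite powRB; last by rewrite (gt_eqF x0) implybT.
by rewrite powRr1 ?(ltW x0)// mulrC.
Qed.

Lemma macdonaldE c :
  macdonald lam c = 2^-1 * fine (haar (fun x => (gig_weight c x)%:E)).
Proof.
rewrite /macdonald /Rintegral; congr (_ * fine _).
rewrite integral_mkcond; apply: eq_integral => x _.
rewrite patchE mem_setE in_itv/= andbT; case: ifPn => [x0|_]; last by rewrite mul0e.
by rewrite powRB1// -EFinM /gig_weight mulrA.
Qed.

(* With [u = x + 1/x], the power [x `^ (lam - 1)] is at most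
   [expR (`|lam - 1| * ln u)], and [ln u <= delta * u - ln delta] lets half of
   the exponential absorb it. *)
Lemma gig_weight_bound (c x : R) : 0 < c -> 0 < x ->
  x^-1 * gig_weight c x <=
  expR (`|lam - 1| * - ln (c / (4 * (`|lam - 1| + 1)))) * expR (- (c / 4) * x).
Proof.
(* [del] is chosen so that [m * del <= c / 4]; the [+ 1] in its denominator keeps it positive when
   [lam = 1]. *)
move=> c0 x0; set m : R := `|_|; set del : R := c / (4 * _).
have m0 : 0 <= m by exact: normr_ge0.
have del0 : 0 < del by rewrite divr_gt0// mulr_gt0// ltr_wpDl.
set u := x + x^-1.
have xu : x <= u by rewrite lerDl invr_ge0 ltW.
have Vxu : x^-1 <= u by rewrite lerDr ltW.
have u0 : 0 < u by rewrite addr_gt0// invr_gt0.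
rewrite /gig_weight mulrA -powRB1// -expRD /powR gt_eqF// -expRD ler_expR.
have lnxu : `|ln x| <= ln u.
  rewrite ler_norml; apply/andP; split; last by rewrite ler_ln.
  by rewrite lerNl -lnV// ler_ln// posrE invr_gt0.
have lnu : ln u <= del * u - ln del.
  have := ln_sublinear (mulr_gt0 del0 u0).
  rewrite lnM// => /ltW; lra.
have h1 : (lam - 1) * ln x <= m * (del * u - ln del).
  apply: (le_trans (ler_norm _)); rewrite normrM ler_wpM2l//.
  exact: le_trans lnu.
have h2 : m * del <= c / 4.
  rewrite /del mulrA ler_pdivrMr ?mulr_gt0 ?ltr_wpDl//.
  have -> : c / 4 * (4 * (m + 1)) = m * c + c by field.
  by rewrite lerDl ltW.
have h3 : m * del * u <= c / 4 * u by rewrite ler_wpM2r ?(ltW u0).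
have h4 : c / 4 * x <= c / 4 * u by rewrite ler_wpM2l// divr_ge0// ltW.
rewrite -/u; lra.
Qed.

Lemma haar_gig_weight_lty c : 0 < c -> (haar (fun x => (gig_weight c x)%:E) < +oo)%E.
Proof.
move=> c0; set C := expR (`|lam - 1| * - ln (c / (4 * (`|lam - 1| + 1)))).
have c4 : 0 < c / 4 by rewrite divr_gt0.
(* [C] is the constant of [gig_weight_bound]; the bound there is [k] times the exponential density
   of rate [c / 4], whose integral is 1. *)
pose k := C / (c / 4).
have k0 : 0 <= k by rewrite divr_ge0 ?expR_ge0// ltW.
have mexp : measurable_fun [set: R] (EFin \o exponential_pdf (c / 4)).
  by apply/measurable_EFinP; exact: measurable_exponential_pdf.
apply: (@le_lt_trans _ _ (k%:E * \int[mu]_x (exponential_pdf (c / 4) x)%:E)%E);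
  last first.
  by rewrite integral_exponential_pdf// mule1 ltry.
rewrite -ge0_integralZl//; last first.
  by move=> x _; rewrite lee_fin exponential_pdf_ge0// ltW.
apply: ge0_le_integral => //.
- move=> x _; rewrite mule_ge0 ?lee_fin ?gig_weight_ge0//.
  by case: ifPn => // x0; rewrite invr_ge0 ltW.
- apply: emeasurable_funM.
    by apply/measurable_EFinP; exact: measurable_haar_weight.
  by apply/measurable_EFinP; exact: (@measurable_gig_weight _ R).
- exact: measurable_funeM.
move=> x _; case: ifPn => [x0|_]; last first.
  by rewrite mul0e mule_ge0// lee_fin exponential_pdf_ge0// ltW.
rewrite -!EFinM lee_fin exponential_pdfE ?(ltW x0)// /k.
by rewrite [leRHS]mulrA divfK ?gt_eqF// gig_weight_bound.
Qed.

(** If the integral vanished, its integrand, which is positive at every [x > 0], would be zero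
    almost everywhere there, and the half-line would be null. *)
Lemma haar_gig_weight_gt0 c : (0 < haar (fun x => (gig_weight c x)%:E))%E.
Proof.
rewrite lt0e haar_ge0 ?andbT; last by move=> x; rewrite lee_fin gig_weight_ge0.
apply/eqP => h0.
have : (\int[mu]_(x in posreals R) `|(x^-1 * gig_weight c x)%:E| = 0)%E.
  rewrite -[RHS]h0 integral_mkcond; apply: eq_integral => x _.
  rewrite patchE mem_setE in_itv/= andbT; case: ifPn => [x0|_]; last by rewrite mul0e.
  by rewrite ger0_norm// mulr_ge0 ?gig_weight_ge0// invr_ge0 ltW.
move/ae_eq_integral_abs => /(_ _ _)[]//.
  apply: measurable_funTS; apply/measurable_EFinP.
  apply: (@measurable_funM _ R); first exact: measurable_invr.
  exact: (@measurable_gig_weight _ R).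
move=> N [mN N0 sub].
have : (mu (posreals R) <= mu N)%E.
  apply: le_measure; rewrite ?inE//.
  move=> x /=; rewrite in_itv/= andbT => x0; apply: sub => /=.
  apply/not_implyP; split; first by rewrite in_itv/= x0.
  move=> /eqP; rewrite eqe gt_eqF// mulr_gt0 ?invr_gt0// mulr_gt0 ?expR_gt0//.
  exact: powR_gt0.
by rewrite N0 lebesgue_measure_itv/= ltry leye_eq.
Qed.

Lemma haar_gig_weight c : 0 < c ->
  haar (fun x => (gig_weight c x)%:E) = (2 * macdonald lam c)%:E.
Proof.
move=> c0; rewrite macdonaldE mulVKf// fineK// ge0_fin_numE ?haar_gig_weight_lty//.
by rewrite ltW// haar_gig_weight_gt0.
Qed.

Lemma macdonald_gt0 c : 0 < c -> 0 < macdonald lam c.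
Proof.
move=> c0; have := haar_gig_weight_gt0 c.
by rewrite haar_gig_weight// lte_fin pmulr_rgt0.
Qed.

End macdonald.

(** * The intertwining relation *)

Section intertwining.
Context (R : realType).
Variables (a lam : R).
Hypothesis a0 : 0 < a.

Let c0 : 0 < a ^+ 2. Proof. exact: exprn_gt0. Qed.

Notation gw := (gig_weight lam).
Notation K := (macdonald lam).

Definition Q_weight (x y : R) : R :=
  expR (- (a ^+ 2 * (x ^+ 2 + y ^+ 2 + 1) / (2 * x * y))).

(** The powers combine to that of [t] alone. In the exponent, g / (z t) + g = y / z, while t / (z g)
    + 1 / g = (t + 1 / t) / y + z / y + 1 / (z y): the variable [t] survives only through (t + 1 /
    t) / y, which is the weight of Lambda(y, .). *)
Lemma gig_weight_change (z t y : R) : 0 < z -> 0 < t -> 0 < y ->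
  let g := t / (z * t + 1) * y in
  gw (a ^+ 2 / z) (g^-1 * t) * gw (a ^+ 2) g =
  Q_weight z y * gw (a ^+ 2 / y) t.
Proof.
move=> z0 t0 y0 g.
have zt0 : 0 < z * t + 1 by rewrite addr_gt0// mulr_gt0.
have g0 : 0 < g by rewrite mulr_gt0// divr_gt0.
have gt0 : 0 <= g^-1 * t by apply/ltW/mulr_gt0 => //; rewrite invr_gt0.
rewrite /gig_weight mulrACA -powRM ?(ltW g0)//.
rewrite mulrAC mulVf ?gt_eqF// mul1r -expRD.
rewrite /Q_weight mulrCA; congr (_ * _); rewrite -expRD; congr expR.
by rewrite /g; field; rewrite !gt_eqF.
Qed.

(** The factor of each scaling depends on the other variable, so the scaled variable must be the
    inner one: an exchange of integrals by [haarC] precedes each substitution, and a last one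
    restores the order of the right-hand side. *)
Lemma haar_change (z : R) (F : R * R -> \bar R) : 0 < z ->
  measurable_fun [set: R * R] F -> (forall p, 0 <= F p)%E ->
  haar (fun x => haar (fun g =>
    (gw (a ^+ 2 / z) x * gw (a ^+ 2) g)%:E * F (x * g, z * g + x^-1)%R))%E =
  haar (fun y => haar (fun t => (Q_weight z y * gw (a ^+ 2 / y) t)%:E * F (t, y)))%E.
Proof.
move=> z0 mF F0.
pose G (p : R * R) := ((gw (a ^+ 2 / z) p.1 * gw (a ^+ 2) p.2)%:E *
  F (p.1 * p.2, z * p.2 + p.1^-1)%R)%E.
have mG : measurable_fun [set: R * R] G.
  apply: emeasurable_funM.
    apply/measurable_EFinP; apply: measurable_funM.
      exact: measurable_gig_weight.
    exact: measurable_gig_weight.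
  apply: (measurableT_comp (g := fun p : R * R => (p.1 * p.2, z * p.2 + p.1^-1)) mF).
  apply: measurable_fun_pair; first exact: measurable_funM.
  apply: measurable_funD; first exact: measurable_funM.
  exact: measurable_fun_invr.
have G0 p : (0 <= G p)%E by rewrite mule_ge0// lee_fin mulr_ge0 ?gig_weight_ge0.
apply: (etrans (haarC mG G0)).
(* [G] in the variables (g, t), where x = t / g. *)
pose H (p : R * R) := G (p.1^-1 * p.2, p.1).
have mH : measurable_fun [set: R * R] H.
  apply: (measurableT_comp (g := fun p : R * R => (p.1^-1 * p.2, p.1)) mG).
  apply: measurable_fun_pair => //; apply: measurable_funM => //.
  exact: measurable_fun_invr.
have H0 p : (0 <= H p)%E by exact: G0.
transitivity (haar (fun g => haar (fun t => H (g, t)))).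
  apply: eq_haar => g g0.
  rewrite -(@haar_scale _ g^-1 (fun x => G (x, g)))//; first by rewrite invr_gt0.
  exact: (measurableT_comp mG (measurable_pair2 g)).
apply: (etrans (haarC mH H0)).
(* [H] in the variables (t, y), where y = z g + 1 / x = g (z t + 1) / t. *)
pose J (p : R * R) := H (p.1 / (z * p.1 + 1) * p.2, p.1).
have mJ : measurable_fun [set: R * R] J.
  apply: (measurableT_comp
    (g := fun p : R * R => (p.1 / (z * p.1 + 1) * p.2, p.1)) mH).
  apply: measurable_fun_pair => //; apply: measurable_funM => //.
  apply: measurable_fun_divr => //; apply: measurable_funD => //.
  exact: measurable_funM.
have J0 p : (0 <= J p)%E by exact: H0.
transitivity (haar (fun t => haar (fun y => J (t, y)))).
  apply: eq_haar => t t0.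
  rewrite -(@haar_scale _ (t / (z * t + 1)) (fun x => H (x, t)))//.
    by rewrite divr_gt0// addr_gt0// mulr_gt0.
  exact: (measurableT_comp mH (measurable_pair2 t)).
apply: (etrans (haarC mJ J0)); apply: eq_haar => y y0; apply: eq_haar => t t0.
rewrite /J /H /G/= gig_weight_change//; congr (_ * F (_, _))%E.
  rewrite mulrAC mulVf ?mul1r// !mulf_neq0 ?invr_eq0 ?gt_eqF//.
  by rewrite addr_gt0// mulr_gt0.
have zt0 : z * t + 1 != 0 by rewrite gt_eqF// addr_gt0// mulr_gt0.
field.
by rewrite zt0 !gt_eqF.
Qed.

Notation N z := ((2 * K (a ^+ 2 / z))^-1).

Lemma integral_kernelLambda z (f : R -> \bar R) : measurable_fun [set: R] f ->
  (forall x, 0 <= f x)%E ->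
  (\int[kernelLambda a lam z]_x f x =
   (N z)%:E * haar (fun x => (gw (a ^+ 2 / z) x)%:E * f x))%E.
Proof.
move=> mf f0; rewrite integral_density_mkernel// -haarZl//; last 3 first.
- by rewrite invr_ge0 mulr_ge0 ?macdonald_ge0.
- apply: emeasurable_funM => //; apply/measurable_EFinP.
  exact: measurable_gig_weight.
- by move=> x; rewrite mule_ge0// lee_fin gig_weight_ge0.
apply: eq_haar => x x0; rewrite muleA -EFinM; congr (_%:E * _)%E.
rewrite /Lambda_density /gig_weight powRB1//; set k := (2 * _)^-1.
have -> : a ^+ 2 / (2 * z) = a ^+ 2 / z / 2 by rewrite invfM mulrA mulrAC.
by rewrite -!mulrA mulrCA mulVKf ?gt_eqF.
Qed.

Lemma kernelLambda_setT z : 0 < z -> kernelLambda a lam z setT = 1%E.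
Proof.
move=> z0.
rewrite -[LHS]mul1e -(integral_cst (kernelLambda a lam z) measurableT).
rewrite integral_kernelLambda//.
under eq_fun do rewrite mule1.
have cz : 0 < a ^+ 2 / z by exact: divr_gt0.
rewrite haar_gig_weight// -EFinM mulVf// gt_eqF// mulr_gt0//.
exact: macdonald_gt0.
Qed.

Lemma kernelLambda1 : kernelLambda a lam 1 = gig_law lam a :> (set R -> \bar R).
Proof.
apply/funext => A; apply: eq_integral => x _.
by rewrite /Lambda_density divr1 mulr1.
Qed.

(** P(x, .) is the law of [x * g] for [g] of law Lambda(1, .): up to dy / y its density depends on y
    / x only, and y = x g preserves that measure. *)
Lemma kernelP_scale (x : R) (B : set R) : 0 < x -> measurable B ->
  (kernelP a lam x B = \int[kernelLambda a lam 1%R]_g (\1_B (x * g)%R)%:E)%E.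
Proof.
move=> x0 mB.
have m1 : measurable_fun [set: R] (fun y => (\1_B y : R)%:E).
  by apply/measurable_EFinP.
have mf : measurable_fun [set: R]
    (fun y => (N 1 * gw (a ^+ 2 / 1) (x^-1 * y) * \1_B y)%:E).
  apply/measurable_EFinP; apply: measurable_funM => //.
  apply: measurable_funM => //; exact: measurable_gig_weight.
rewrite integral_density_mkernel//; last first.
  by apply: (measurableT_comp m1); exact: measurable_funM.
transitivity (haar (fun y => (N 1 * gw (a ^+ 2 / 1) (x^-1 * y) * \1_B y)%:E)).
  have -> : kernelP a lam x B = (\int[kernelP a lam x]_y (\1_B y)%:E)%E.
    by rewrite integral_indic// setIT.
  apply: etrans; first exact: integral_density_mkernel.
  apply: eq_haar => y y0; rewrite -EFinM; congr (_ * _)%:E.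
  rewrite /P_density powRB1// divr1 /gig_weight.
  have -> : y `^ lam = x `^ lam * (x^-1 * y) `^ lam.
    rewrite -powRM ?(ltW x0) ?mulr_ge0 ?invr_ge0 ?(ltW x0) ?(ltW y0)//.
    by rewrite mulVKf ?gt_eqF.
  have xl : x `^ lam != 0 by rewrite gt_eqF// powR_gt0.
  set k := (2 * _)^-1.
  have -> : x^-1 * y + (x^-1 * y)^-1 = y / x + x / y by rewrite invfM invrK mulrC.
  by field; rewrite xl gt_eqF.
have f0 y : (0 <= (N 1 * gw (a ^+ 2 / 1) (x^-1 * y) * \1_B y)%:E)%E.
  rewrite lee_fin; apply: mulr_ge0 => //; apply: mulr_ge0.
    by rewrite invr_ge0 mulr_ge0 ?macdonald_ge0.
  exact: gig_weight_ge0.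
apply: (etrans (esym (haar_scale x0 mf f0))).
apply: eq_haar => y y0; rewrite -EFinM mulKf ?gt_eqF//; congr (_ * _)%:E.
rewrite /Lambda_density /gig_weight powRB1//; set k := (2 * _)^-1.
have -> : a ^+ 2 / (2 * 1) = a ^+ 2 / 1 / 2 by rewrite !divr1 mulr1.
by rewrite -!mulrA [RHS]mulrCA mulVKf ?gt_eqF.
Qed.

Lemma measurable_fun_step (F : R * R -> \bar R) : measurable_fun [set: R * R] F ->
  measurable_fun [set: R * R * R]
    (fun p => F (p.1.1 * p.2, p.1.2 * p.2 + p.1.1^-1)).
Proof.
move=> mF.
apply: (measurableT_comp
  (g := fun p : R * R * R => (p.1.1 * p.2, p.1.2 * p.2 + p.1.1^-1)) mF).
apply: measurable_fun_pair.
  by apply: measurable_funM => //; exact: measurableT_comp.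
apply: measurable_funD; last by apply: measurable_fun_invr; exact: measurableT_comp.
by apply: measurable_funM => //; exact: measurableT_comp.
Qed.

(** [haar_change] is this identity without normalisation. The constants agree because the ratio of
    Macdonald functions in [Q_density] trades the constant of Lambda(z, .) for that of Lambda(y, .):
    [N z * N 1 * Q_weight z y] equals [y * Q_density a lam z y * N y]. *)
Lemma intertwining_integral (z : R) (F : R * R -> \bar R) : 0 < z ->
  measurable_fun [set: R * R] F -> (forall p, 0 <= F p)%E ->
  (\int[kernelLambda a lam z]_x
     \int[kernelLambda a lam 1%R]_g F (x * g, z * g + x^-1)%R =
   \int[kernelQ a lam z]_y \int[kernelLambda a lam y]_t F (t, y))%E.
Proof.
move=> z0 mF F0.
have N0 y : 0 <= N y by rewrite invr_ge0 mulr_ge0 ?macdonald_ge0.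
pose G (p : R * R * R) := F (p.1.1 * p.2, p.1.2 * p.2 + p.1.1^-1).
have mG : measurable_fun [set: R * R * R] G by exact: measurable_fun_step.
have mGx (x : R) : measurable_fun [set: R] (fun g => F (x * g, z * g + x^-1)).
  exact: (measurableT_comp mG (measurable_pair1 (x, z))).
have mgw u : measurable_fun [set: R] (fun g => (gw u g)%:E).
  by apply/measurable_EFinP; exact: measurable_gig_weight.
have gw0 u g : (0 <= (gw u g)%:E)%E by rewrite lee_fin gig_weight_ge0.
have mL : measurable_fun [set: R]
    (fun x => \int[kernelLambda a lam 1%R]_g F (x * g, z * g + x^-1)%R)%E.
  apply: (@measurable_integral_density_mkernel R _ (@Lambda_density_ge0 R a lam)
    (measurable_Lambda_density a lam) _ _ (fun=> 1)
    (fun p : R * R => G ((p.1, z), p.2))) => //; last by move=> p; exact: F0.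
  apply: (measurableT_comp (g := fun p : R * R => ((p.1, z), p.2)) mG).
  by apply: measurable_fun_pair => //; exact: measurable_fun_pair.
have L0 x : (0 <= \int[kernelLambda a lam 1%R]_g F (x * g, z * g + x^-1)%R)%E.
  by apply: integral_ge0.
rewrite integral_kernelLambda//.
have mFy (y : R) : measurable_fun [set: R] (fun t => F (t, y)).
  exact: (measurableT_comp mF (measurable_pair2 y)).
have mFF : measurable_fun [set: R] (fun y => \int[kernelLambda a lam y]_t F (t, y))%E.
  apply: (@measurable_integral_density_mkernel R _ (@Lambda_density_ge0 R a lam)
    (measurable_Lambda_density a lam) _ _ id (fun p : R * R => F (p.2, p.1))) => //.
  apply: (measurableT_comp (g := fun p : R * R => (p.2, p.1)) mF).
  exact: measurable_fun_pair.
have FF0 y : (0 <= \int[kernelLambda a lam y]_t F (t, y))%E.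
  by apply: integral_ge0.
rewrite [RHS]integral_density_mkernel//.
transitivity ((N z * N 1)%:E *
  haar (fun x => haar (fun g =>
    (gw (a ^+ 2 / z) x * gw (a ^+ 2) g)%:E * F (x * g, z * g + x^-1)%R)))%E.
  rewrite EFinM -muleA; congr (_ * _)%E; rewrite -haarZl//; last 2 first.
  - apply: (measurable_haar (f := fun p : R * R => ((gw (a ^+ 2 / z) p.1 *
      gw (a ^+ 2) p.2)%:E * G ((p.1, z), p.2))%E)); last first.
      move=> p; apply: mule_ge0; last exact: F0.
      by rewrite lee_fin mulr_ge0 ?gig_weight_ge0.
    apply: emeasurable_funM.
      by apply/measurable_EFinP; apply: measurable_funM; exact: measurable_gig_weight.
    apply: (measurableT_comp (g := fun p : R * R => ((p.1, z), p.2)) mG).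
    by apply: measurable_fun_pair => //; exact: measurable_fun_pair.
  - move=> x; apply: haar_ge0 => g; apply: mule_ge0 => //.
    by rewrite lee_fin mulr_ge0 ?gig_weight_ge0.
  apply: eq_haar => x x0; rewrite integral_kernelLambda// divr1 muleCA.
  congr (_ * _)%E; rewrite -haarZl ?gig_weight_ge0//; last 2 first.
  - exact: emeasurable_funM.
  - by move=> g; exact: mule_ge0.
  by apply: eq_haar => g g0; rewrite muleA.
rewrite haar_change// -haarZl; last 3 first.
- exact: mulr_ge0.
- apply: (measurable_haar (f := fun p : R * R => ((Q_weight z p.1 *
    gw (a ^+ 2 / p.1) p.2)%:E * F (p.2, p.1))%E)); last first.
    move=> p; apply: mule_ge0; last exact: F0.
    by rewrite lee_fin mulr_ge0 ?expR_ge0 ?gig_weight_ge0.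
  apply: emeasurable_funM.
    apply/measurable_EFinP; apply: measurable_funM; last first.
      by apply: measurable_gig_weight => //; exact: measurable_fun_divr.
    rewrite /Q_weight; apply: measurableT_comp => //; apply: measurableT_comp => //.
    apply: measurable_fun_divr; apply: measurable_funM => //.
    by apply: measurable_funD => //; apply: measurable_funD => //;
      exact: measurable_funX.
  apply: (measurableT_comp (g := fun p : R * R => (p.2, p.1)) mF).
  exact: measurable_fun_pair.
- move=> y; apply: haar_ge0 => t; apply: mule_ge0 => //.
  by rewrite lee_fin mulr_ge0 ?expR_ge0 ?gig_weight_ge0.
apply: eq_haar => y y0; rewrite integral_kernelLambda//.
rewrite [RHS]muleA -EFinM.
transitivity ((N z * N 1 * Q_weight z y)%:E *
   haar (fun x : R => (gw (a ^+ 2 / y) x)%:E * F (x, y)))%E.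
  rewrite [in RHS]EFinM -[RHS]muleA; congr (_ * _)%E.
  rewrite -haarZl ?expR_ge0//; last 2 first.
  - exact: emeasurable_funM.
  - by move=> t; exact: mule_ge0.
  by apply: eq_haar => x x0; rewrite muleA.
congr (_%:E * _)%E; rewrite /Q_density -/(Q_weight z y) divr1.
have Kz : K (a ^+ 2 / z) != 0 by rewrite gt_eqF// macdonald_gt0// divr_gt0.
have Ky : K (a ^+ 2 / y) != 0 by rewrite gt_eqF// macdonald_gt0// divr_gt0.
have K1 : K (a ^+ 2) != 0 by rewrite gt_eqF// macdonald_gt0.
move: Kz Ky K1 (Q_weight z y).
move: (K (a ^+ 2 / z)) (K (a ^+ 2 / y)) (K (a ^+ 2)) => k1 k2 k3 k10 k20 k30 q.
by field; rewrite k10 k20 k30 gt_eqF.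
Qed.
End intertwining.

(** * Total masses of the kernels and the relation between them *)

Section markov_kernels.
Context (R : realType).

Section density.
Variables (k : R -> R -> R) (k0 : forall x y, 0 < y -> 0 <= k x y).
Hypothesis mk : measurable_fun [set: R * R] (fun p => k p.1 p.2).

Lemma markov_density_mkernel :
  (forall x, 0 < x -> density_mkernel k0 mk x setT = 1%E) ->
  markov_kernel_on (posreals R) (density_mkernel k0 mk).
Proof.
move=> k1 x; rewrite /= in_itv/= andbT => x0; split.
  by rewrite -(k1 _ x0)/= /density_kernel setTI setIid.
by rewrite /= /density_kernel setICl integral_set0.
Qed.
End density.

Variables (a lam : R).
Hypothesis a0 : 0 < a.

Lemma kernelP_setT x : 0 < x -> kernelP a lam x setT = 1%E.
Proof.
move=> x0; rewrite kernelP_scale// -(kernelLambda_setT lam a0 (@ltr01 R)).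
rewrite -[RHS]mul1e -[RHS]integral_cst//.
by apply: eq_integral => g _; rewrite indicT.
Qed.

Lemma kernelQ_setT x : 0 < x -> kernelQ a lam x setT = 1%E.
Proof.
move=> x0.
have L1 y : 0 < y -> (\int[kernelLambda a lam y]_t cst 1 (t, y))%E = 1%E.
  by move=> y0; rewrite integral_cst// mul1e kernelLambda_setT.
have := intertwining_integral lam a0 x0 (F := cst 1%E)
  (measurable_cst _) (fun=> lee01).
rewrite (eq_integral (cst 1%E)); last first.
  by move=> y _; rewrite integral_cst// mul1e kernelLambda_setT.
rewrite integral_cst// mul1e kernelLambda_setT// => ->.
rewrite -[LHS]mul1e -integral_cst//; apply: eq_integral_density_mkernel => //.
- exact: (@measurable_integral_density_mkernel R _ (@Lambda_density_ge0 R a lam)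
    (measurable_Lambda_density a lam) _ _ id (cst 1%E)).
- by move=> y; apply: integral_ge0.
- by move=> y y0; rewrite L1.
Qed.

Lemma intertwines_kernelLambda :
  intertwines (posreals R) (kernelLambda a lam) (kernelP a lam) (kernelQ a lam).
Proof.
split; first by apply: markov_density_mkernel => x; exact: kernelLambda_setT.
move=> u; rewrite /= in_itv/= andbT => u0 A mA.
have mF : measurable_fun [set: R * R] (fun p => (\1_A p.1 : R)%:E).
  apply/measurable_EFinP.
  exact: (measurableT_comp (@measurable_indic _ _ R setT A mA) measurable_fst).
have F0 (p : R * R) : (0 <= (\1_A p.1 : R)%:E)%E by rewrite lee_fin.
transitivity (\int[kernelLambda a lam u]_x
    \int[kernelLambda a lam 1%R]_g (\1_A (x * g)%R)%:E)%E.
  apply: eq_integral_density_mkernel => //.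
  - exact: (measurable_kernel (kernelP a lam)).
  - apply: (@measurable_integral_density_mkernel R _ (@Lambda_density_ge0 R a lam)
      (measurable_Lambda_density a lam) _ _ (fun=> 1%R)
      (fun p : R * R => (\1_A (p.1 * p.2))%:E)) => //.
    apply/measurable_EFinP.
    apply: (measurableT_comp (@measurable_indic _ _ R setT A mA)).
    exact: measurable_funM.
  - by move=> x; apply: integral_ge0 => g _; rewrite lee_fin.
  - by move=> x x0; rewrite kernelP_scale.
rewrite (intertwining_integral lam a0 u0 mF F0).
by apply: eq_integral => y _; rewrite /= integral_indic// setIT.
Qed.
End markov_kernels.

(** * Conditional laws *)

Section density_measure.
Context d (T : measurableType d) (R : realType).
Variables (mu : {measure set T -> \bar R}) (h : T -> \bar R).

Definition density_measure of measurable_fun [set: T] h & (forall x, 0 <= h x)%E :=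
  fun A : set T => (\int[mu]_(x in A) h x)%E.

Hypothesis mh : measurable_fun [set: T] h.
Hypothesis h0 : forall x, (0 <= h x)%E.

Let nu0 : density_measure mh h0 set0 = 0%E.
Proof. exact: integral_set0. Qed.

Let nu_ge0 A : (0 <= density_measure mh h0 A)%E.
Proof. exact: integral_ge0. Qed.

Let nu_sigma : semi_sigma_additive (density_measure mh h0).
Proof. exact: semi_sigma_additive_nng_induced. Qed.

HB.instance Definition _ := isMeasure.Build _ _ _ (density_measure mh h0)
  nu0 nu_ge0 nu_sigma.
End density_measure.

Lemma ge0_integral_mrestr d (T : measurableType d) (R : realType)
    (mu : {measure set T -> \bar R}) (D : set T) (mD : measurable D)
    (f : T -> \bar R) :
  measurable_fun [set: T] f -> (forall x, 0 <= f x)%E ->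
  (\int[mrestr mu mD]_x f x = \int[mu]_(x in D) f x)%E.
Proof.
move=> mf f0; rewrite (@integral_density _ T R mu _ \1_D)//.
- rewrite [RHS]integral_mkcond; apply: eq_integral => x _.
  by rewrite patchE indicE; case: ifPn; rewrite ?mul1e ?mul0e.
- by move=> A mA; rewrite integral_indic// /mrestr setIC.
Qed.

Section disintegration.
Context d (T : measurableType d) (R : realType) (Pr : probability T R).
Context d' (S : measurableType d').
Variables (k : R -> R -> R) (k0 : forall x y, 0 < y -> 0 <= k x y).
Hypothesis mk : measurable_fun [set: R * R] (fun p => k p.1 p.2).
Variables (A : set T) (V : T -> S) (U Y : T -> R).
Hypotheses (mA : measurable A) (mV : measurable_fun [set: T] V).
Hypotheses (mU : measurable_fun [set: T] U) (mY : measurable_fun [set: T] Y).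

Notation kap := (density_mkernel k0 mk).
Notation mu := (@lebesgue_measure R).

Hypothesis cond : forall C B, measurable C -> measurable B ->
  (Pr (A `&` V @^-1` C `&` Y @^-1` B) = \int[Pr]_(w in A `&` V @^-1` C) kap (U w) B)%E.

(** Density, with respect to [Pr] times Lebesgue measure, of the measure on [T * R] that draws [w]
    in [A] and then [y] from [kap (U w)]. Having a density reduces its integrals to Tonelli. *)
Let h (p : T * measurableTypeR R) : R :=
  \1_A p.1 * (if 0 < p.2 then k (U p.1) p.2 else 0).

Let mh : measurable_fun [set: T * measurableTypeR R] h.
Proof.
apply: measurable_funM.
  exact: (measurableT_comp (@measurable_indic _ _ R setT A mA) measurable_fst).
apply: measurable_fun_ifT => //; first exact: (@measurable_fun_ltr _ (T * R)%type).
apply: (measurableT_comp (g := fun p : T * R => (U p.1, p.2)) mk).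
by apply: measurable_fun_pair => //; exact: measurableT_comp.
Qed.

Let h0 p : 0 <= h p.
Proof. by rewrite mulr_ge0//; case: ifPn => // p0; exact: k0. Qed.

Let mhE : measurable_fun [set: T * measurableTypeR R] (EFin \o h).
Proof. exact/measurable_EFinP. Qed.

Let hE0 p : (0 <= (EFin \o h) p)%E.
Proof. by rewrite lee_fin. Qed.

Let phi (p : T * measurableTypeR R) : S * R := (V p.1, p.2).

Let mphi : measurable_fun [set: T * measurableTypeR R] phi.
Proof.
by apply: (@measurable_fun_pair _ _ _ (T * R)%type) => //; exact: measurableT_comp.
Qed.

Let psi (w : T) : S * R := (V w, Y w).

Let mpsi : measurable_fun [set: T] psi.
Proof. exact: measurable_fun_pair. Qed.

Let m1 := measure_function_pushforward__canonical__measure_function_Measure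
  (mrestr Pr mA) mpsi.
Let m2 := measure_function_pushforward__canonical__measure_function_Measure
  (density_measure (Pr \x mu)%E mhE hE0) mphi.

Let m1E (F : S * R -> \bar R) : measurable_fun [set: S * R] F ->
  (forall p, 0 <= F p)%E -> (\int[m1]_p F p = \int[Pr]_(w in A) F (V w, Y w))%E.
Proof.
move=> mF F0; rewrite ge0_integral_pushforward//.
by rewrite ge0_integral_mrestr//=; exact: measurableT_comp.
Qed.

Let m2E (F : S * R -> \bar R) : measurable_fun [set: S * R] F ->
  (forall p, 0 <= F p)%E ->
  (\int[m2]_p F p = \int[Pr]_(w in A) \int[kap (U w)]_y F (V w, y))%E.
Proof.
move=> mF F0; rewrite ge0_integral_pushforward//.
have mFphi : measurable_fun [set: T * measurableTypeR R] (F \o phi).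
  exact: measurableT_comp.
have Fphi0 p : (0 <= (F \o phi) p)%E by exact: F0.
rewrite (@integral_density _ _ R (Pr \x mu)%E _ h)//.
have hF0 p : (0 <= (h p)%:E * (F \o phi) p)%E by rewrite mule_ge0// lee_fin.
have mhF : measurable_fun [set: T * measurableTypeR R]
    (fun p => (h p)%:E * (F \o phi) p)%E.
  by apply: emeasurable_funM => //; exact/measurable_EFinP.
rewrite fubini_tonelli1//.
rewrite [RHS]integral_mkcond; apply: eq_integral => w _.
rewrite patchE; transitivity (\int[mu]_y
  ((\1_A w * (if 0 < y then k (U w) y else 0))%:E * F (V w, y)))%E; first by [].
rewrite indicE; case: ifPn => wA; last first.
  by rewrite integral0_eq// => y _; rewrite mul0r mul0e.
rewrite integral_density_mkernel//; last first.
  exact: (measurableT_comp mF (measurable_pair1 (V w))).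
apply: eq_integral => y _; rewrite mul1r muleA -EFinM; congr (_%:E * _)%E.
by case: ifPn => y0; rewrite ?mul0r// mulKf ?gt_eqF.
Qed.

(** Both sides integrate [F] against finite measures on [S * R]: the law of [(V, Y)] restricted to
    [A], and the image of the measure of density [h]. Hypothesis [cond] says that they agree on
    rectangles, a generating family stable under intersection. *)
Lemma integral_conditional_law (F : S * R -> \bar R) :
  measurable_fun [set: S * R] F -> (forall p, 0 <= F p)%E ->
  (\int[Pr]_(w in A) F (V w, Y w) =
   \int[Pr]_(w in A) \int[kap (U w)]_y F (V w, y))%E.
Proof.
move=> mF F0; rewrite -m1E// -m2E//.
apply: eq_measure_integral => E mE _.
pose G := [set C `*` B | C in @measurable _ S & B in @measurable _ R].
apply: (measure_unique G (fun=> setT)) => //.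
- exact: measurable_prod_measurableType.
- move=> _ _ [C1 mC1 [B1 mB1 <-]] [C2 mC2 [B2 mB2 <-]].
  rewrite -setXI; exists (C1 `&` C2); first exact: measurableI.
  by exists (B1 `&` B2) => //; exact: measurableI.
- by move=> _; exists setT => //; exists setT => //; rewrite setXTT.
- exact: bigcup_const.
- move=> _ [C mC [B mB <-]].
  have mCB : measurable (C `*` B) by exact: measurableX.
  have mI : measurable_fun [set: S * R] (fun p => (\1_(C `*` B) p : R)%:E).
    exact/measurable_EFinP/measurable_indic.
  have I0 p : (0 <= (\1_(C `*` B) p : R)%:E)%E by rewrite lee_fin.
  rewrite -[C `*` B]setIT -!integral_indic// m1E// m2E//.
  have mVC : measurable (V @^-1` C) by rewrite -[X in measurable X]setTI; exact: mV.
  have mYB : measurable (Y @^-1` B) by rewrite -[X in measurable X]setTI; exact: mY.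
  transitivity (Pr (A `&` V @^-1` C `&` Y @^-1` B)).
    rewrite -setIA setIC -integral_indic//; last exact: measurableI.
  rewrite cond// integral_mkcondr; apply: eq_integral => w _.
  rewrite patchE; case: ifPn => [/set_mem wC|/negP wC].
    rewrite -[B in LHS]setIT -integral_indic//; apply: eq_integral => y _.
    congr (_%:E); rewrite !indicE; congr (nat_of_bool _)%:R.
    by apply/idP/idP; rewrite !inE => //; case.
  rewrite integral0_eq// => y _; congr (_%:E); rewrite indicE memNset//= => -[wC' _].
  by apply: wC; rewrite inE.
- move=> _; rewrite /= /pushforward preimage_setT /mrestr setTI.
  by rewrite (le_lt_trans (probability_le1 Pr mA))// ltry.
Qed.
End disintegration.

(** * Sigma-algebras generated by random variables *)

Section generated_sigma_algebras.
Context d (T : measurableType d) (R : realType) (Pr : probability T R).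

Lemma g_sigma_algebra_sub (G : set_system T) :
  G `<=` measurable -> <<s G >> `<=` measurable.
Proof. by apply: smallest_sub; exact: sigma_algebra_measurable. Qed.

Lemma measurable_fun_sub_sigma d' (S : measurableType d') (G : set_system T)
    (f : T -> S) : G `<=` measurable ->
  measurable_fun [set: g_sigma_algebraType G] f -> measurable_fun [set: T] f.
Proof.
move=> Gm mf _ B mB; rewrite setTI; apply: (g_sigma_algebra_sub Gm).
by rewrite -[X in <<s _ >> X]setTI; exact: mf.
Qed.

Lemma measurable_generators (J : set nat) (X : nat -> {RV Pr >-> R}) :
  generators J X `<=` measurable.
Proof. by move=> _ [k _ [B mB <-]]; exact: measurable_funP. Qed.

Lemma measurable_fun_generators (J : set nat) (X : nat -> {RV Pr >-> R}) k :
  J k -> measurable_fun [set: g_sigma_algebraType (generators J X)] (X k).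
Proof.
by move=> Jk _ B mB; apply: sub_sigma_algebra; exists k => //; exists B.
Qed.

Lemma sub_generators (J : set nat) (X : nat -> {RV Pr >-> R}) (G : set_system T) :
  (forall k, J k -> measurable_fun [set: g_sigma_algebraType G] (X k)) ->
  <<s generators J X >> `<=` <<s G >>.
Proof.
move=> mX; apply: smallest_sub; first exact: smallest_sigma_algebra.
by move=> _ [k Jk [B mB <-]]; exact: mX.
Qed.

(** Transfers to the chains the kernel identities, which are known only at positive points. *)
Lemma eq_integral_ae_pos (A : set T) (f g : T -> \bar R) (Z : T -> R) :
  measurable A -> measurable_fun [set: T] f -> measurable_fun [set: T] g ->
  (forall w, 0 <= f w)%E -> (forall w, 0 <= g w)%E ->
  {ae Pr, forall w, 0 < Z w} -> (forall w, 0 < Z w -> f w = g w) ->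
  (\int[Pr]_(w in A) f w = \int[Pr]_(w in A) g w)%E.
Proof.
move=> mA mf mg f0 g0 Z0 fg; apply: ge0_ae_eq_integral => //.
- exact: measurable_funTS.
- exact: measurable_funTS.
- by apply: filterS Z0 => w /fg.
Qed.
End generated_sigma_algebras.

(** * The chains X and Z *)

Section gig_chain.
Context d (T : measurableType d) (R : realType) (Pr : probability T R).
Variables (a lam : R) (gam : nat -> {RV Pr >-> R}).
Hypothesis a0 : 0 < a.
Hypothesis gam_indep : mutually_independent gam.
Hypothesis gam_law : forall (n : nat) (A : set R), measurable A ->
  distribution Pr (gam n) A = gig_law lam a A.

Notation Lam := (kernelLambda a lam).

Let gamE n B : measurable B -> Pr (gam n @^-1` B) = Lam 1 B.
Proof. by move=> mB; rewrite kernelLambda1 -(gam_law n). Qed.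

(** Generates the sigma-algebra of [gam 0, ..., gam (n - 1)]. Unlike [generators], it is stable
    under intersection, as uniqueness of measures requires. For [n = 0] the intersection is empty,
    and the sigma-algebra is trivial. *)
Definition past_rectangles (n : nat) : set_system T :=
  [set E | exists2 B : nat -> set R, (forall i, measurable (B i)) &
    E = \bigcap_(i in [set` iota 0 n]) gam i @^-1` B i].

Let measurable_gam_preimage n B : measurable B -> measurable (gam n @^-1` B).
Proof. by move=> mB; rewrite -[X in measurable X]setTI; exact: measurable_funP. Qed.

Lemma measurable_past_rectangles n : past_rectangles n `<=` measurable.
Proof.
move=> _ [B mB ->]; apply: bigcap_measurableType => k _.
exact: measurable_gam_preimage.
Qed.

Lemma past_rectangles_setI n : setI_closed (past_rectangles n).
Proof.
move=> _ _ [B mB ->] [C mC ->]; exists (fun i => B i `&` C i).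
  by move=> i; exact: measurableI.
by rewrite -bigcapI; apply: eq_bigcapr => i _; rewrite preimage_setI.
Qed.

Lemma past_rectanglesT n : past_rectangles n setT.
Proof.
exists (fun=> setT) => //; apply/esym; rewrite -subTset => w _ i _.
by rewrite preimage_setT.
Qed.

Lemma measurable_gam_past n i : (i < n)%N ->
  measurable_fun [set: g_sigma_algebraType (past_rectangles n)] (gam i).
Proof.
move=> ni _ B mB; rewrite setTI; apply: sub_sigma_algebra.
exists (fun j => if j == i then B else setT); first by move=> j; case: ifP.
apply/seteqP; split=> [w Bw j _|w].
  by case: ifPn => // /eqP ->.
move=> /(_ i); rewrite eqxx; apply => /=.
by rewrite mem_iota.
Qed.

Lemma measurable_procX_past n k : (k <= n)%N ->
  measurable_fun [set: g_sigma_algebraType (past_rectangles n)] (procX gam k).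
Proof.
move=> kn; apply: measurable_prod => i; rewrite mem_index_iota => /andP[_ ik].
by apply: measurable_gam_past; exact: leq_trans kn.
Qed.

Lemma procX0 w : procX gam 0 w = 1.
Proof. by rewrite /procX big_geq. Qed.

Lemma procZ0 w : procZ gam 0 w = 0.
Proof. by rewrite /procZ big_geq. Qed.

Lemma procXS n w : procX gam n.+1 w = procX gam n w * gam n w.
Proof. by rewrite /procX big_nat_recr. Qed.

Lemma procZS n w : procZ gam n.+1 w = procZ gam n w * gam n w + (procX gam n w)^-1.
Proof.
rewrite /procZ big_nat_recr//= [X in _ * X]big_geq// mulr1 /procX prodfV.
congr (_ + _); rewrite mulr_suml; apply: eq_big_nat => k /andP[_ kn].
by rewrite [in LHS]big_nat_recr//= mulrA.
Qed.

Lemma procX1 w : procX gam 1 w = gam 0%N w.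
Proof. by rewrite procXS procX0 mul1r. Qed.

Lemma procZ1 w : procZ gam 1 w = 1.
Proof. by rewrite procZS procZ0 procX0 mul0r add0r invr1. Qed.

Lemma measurable_procZ_past n k : (k <= n)%N ->
  measurable_fun [set: g_sigma_algebraType (past_rectangles n)] (procZ gam k).
Proof.
elim: k => [|k IH] kn.
  by rewrite (funext procZ0); exact: measurable_cst.
rewrite (funext (procZS k)); apply: measurable_funD.
  apply: measurable_funM; first by apply: IH; exact: ltnW.
  exact: measurable_gam_past.
by apply: measurable_fun_invr; apply: measurable_procX_past; exact: ltnW.
Qed.

Lemma gam_ae_gt0 : {ae Pr, forall w n, 0 < gam n w}.
Proof.
apply: ae_foralln => n; exists (gam n @^-1` (~` posreals R)); split.
- exact/measurable_gam_preimage/measurableC.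
- apply: (etrans (gamE n _)); first exact: measurableC.
  have pos1 : posreals R 1 by rewrite /= in_itv/= ltr01.
  by have [_] := markov_density_mkernel (kernelLambda_setT lam a0) pos1.
- by move=> w /=; rewrite in_itv/= andbT.
Qed.

Lemma procX_gt0 n w : (forall n, 0 < gam n w) -> 0 < procX gam n w.
Proof.
by move=> g0; elim: n => [|n IH]; rewrite ?procX0// procXS mulr_gt0.
Qed.

Lemma procZ_gt0 n w : (1 <= n)%N -> (forall n, 0 < gam n w) -> 0 < procZ gam n w.
Proof.
case: n => // n _ g0; rewrite procZS ltr_wpDl ?invr_gt0 ?procX_gt0//.
rewrite mulr_ge0 ?(ltW (g0 _))//; elim: n => [|n IH]; first by rewrite procZ0.
by rewrite procZS addr_ge0 ?invr_ge0 ?mulr_ge0 ?(ltW (procX_gt0 _ g0)) ?(ltW (g0 _)).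
Qed.

(** Both sides are finite measures in [E]; mutual independence makes them equal on past rectangles,
    hence on the generated sigma-algebra. *)
Lemma gam_indep_past n E B : <<s past_rectangles n >> E -> measurable B ->
  Pr (E `&` gam n @^-1` B) = (Pr E * Lam 1%R B)%E.
Proof.
move=> nE mB.
have mgB : measurable (gam n @^-1` B) by exact: measurable_gam_preimage.
have fB : Lam 1 B \is a fin_num by rewrite -(gamE n)// fin_num_measure.
have B0 : 0 <= fine (Lam 1 B) by rewrite fine_ge0.
rewrite -(fineK fB) muleC.
apply: (@g_sigma_algebra_measure_unique _ _ _ (past_rectangles n)
  (@measurable_past_rectangles n) (fun=> setT) _ _ (mrestr Pr mgB)
  (mscale (NngNum B0) Pr) _ _ _ E) => //.
- by move=> _; exact: past_rectanglesT.
- exact: bigcup_const.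
- exact: past_rectangles_setI.
- move=> _ [C mC ->].
  set D := \bigcap_(i in _) _.
  transitivity ((fine (Lam 1%R B))%:E * Pr D)%E; last by [].
  rewrite fineK// -(gamE n)// muleC.
  (* With [B] placed at index [n], the product formula over the indices up to [n] splits off the
     factor of [gam n]. *)
  pose C' i := if i == n then B else C i.
  have mC' i : measurable (C' i) by rewrite /C'; case: ifP.
  have C'n i : i \in iota 0 n -> C' i = C i.
    by rewrite mem_iota /= add0n /C' => iltn; rewrite ltn_eqF.
  have C'nn : C' n = B by rewrite /C' eqxx.
  have /esym := gam_indep (iota_uniq 0 n.+1) mC'.
  rewrite -[in iota _ _]addn1 iotaD/= add0n big_cat/= big_seq1 C'nn.
  rewrite big_seq; under eq_bigr do rewrite C'n//.
  rewrite -big_seq -gam_indep ?iota_uniq// => ->.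
  congr (Pr _); apply/seteqP; split=> [w [Dw nw] i|w Dw]; last first.
    split=> [i /= ni|]; last first.
      by have := Dw n; rewrite C'nn; apply; rewrite /= mem_cat mem_seq1 eqxx orbT.
    by rewrite -C'n//; apply: Dw; rewrite /= mem_cat ni.
  rewrite /= mem_cat mem_seq1 => /orP[ni|/eqP->]; first by rewrite C'n//; exact: Dw.
  by rewrite C'nn.
- by move=> _; rewrite /= /mrestr setTI (le_lt_trans (probability_le1 Pr mgB))// ltry.
Qed.

(** Independence is read as a conditional law that does not vary: given the past, [gam n] has law
    Lambda(1, .), hence the constant parameter 1 in the disintegration. *)
Lemma integral_gam_past d' (S : measurableType d') n (A : set T) (V : T -> S)
    (F : S * R -> \bar R) :
  <<s past_rectangles n >> A ->
  measurable_fun [set: g_sigma_algebraType (past_rectangles n)] V ->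
  measurable_fun [set: S * R] F -> (forall p, 0 <= F p)%E ->
  (\int[Pr]_(w in A) F (V w, gam n w) =
   \int[Pr]_(w in A) \int[Lam 1%R]_g F (V w, g))%E.
Proof.
move=> nA mV mF F0; have pm := @measurable_past_rectangles n.
apply: (@integral_conditional_law _ _ _ _ _ _ _ (@Lambda_density_ge0 R a lam)
  (measurable_Lambda_density a lam) A V (fun=> 1%R) (gam n)) => //.
- exact: g_sigma_algebra_sub nA.
- exact: measurable_fun_sub_sigma mV.
move=> C B mC mB.
have nAC : <<s past_rectangles n >> (A `&` V @^-1` C).
  apply: (@measurableI _ (g_sigma_algebraType (past_rectangles n))) => //.
  by rewrite -[X in measurable X]setTI; exact: mV.
rewrite gam_indep_past// muleC; apply/esym.
exact: (integral_cst Pr (g_sigma_algebra_sub pm nAC) (Lam 1 B)).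
Qed.

Notation sigmaZ n := (generators [set i | (1 <= i <= n)%N] (rvZ gam)).

Let rvX_ae_gt0 n : {ae Pr, forall w, 0 < rvX gam n w}.
Proof. by apply: filterS gam_ae_gt0 => w; exact: procX_gt0. Qed.

Let rvZ_ae_gt0 n : (1 <= n)%N -> {ae Pr, forall w, 0 < rvZ gam n w}.
Proof. by move=> n1; apply: filterS gam_ae_gt0 => w; exact: procZ_gt0. Qed.

Let sigmaZ_past n : <<s sigmaZ n >> `<=` <<s past_rectangles n >>.
Proof.
by apply: sub_generators => k /= /andP[_ kn]; exact: measurable_procZ_past.
Qed.

Let measurable_sigmaZ n A : <<s sigmaZ n >> A -> measurable A.
Proof. by apply: g_sigma_algebra_sub; exact: measurable_generators. Qed.

Let measurable_integral_Lam d' (S : measurableType d') (u : S -> R)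
    (F : S * R -> \bar R) : measurable_fun [set: S] u ->
  measurable_fun [set: S * R] F -> (forall p, 0 <= F p)%E ->
  measurable_fun [set: S] (fun s => \int[Lam (u s)]_y F (s, y))%E.
Proof.
exact: (@measurable_integral_density_mkernel R _ (@Lambda_density_ge0 R a lam)
  (measurable_Lambda_density a lam)).
Qed.

Let measurable_integral_Q d' (S : measurableType d') (u : S -> R)
    (F : S * R -> \bar R) : measurable_fun [set: S] u ->
  measurable_fun [set: S * R] F -> (forall p, 0 <= F p)%E ->
  measurable_fun [set: S] (fun s => \int[kernelQ a lam (u s)]_y F (s, y))%E.
Proof.
exact: (@measurable_integral_density_mkernel R _ (@Q_density_ge0 R a lam)
  (measurable_Q_density a lam)).
Qed.

(** The whole past of Z is kept, and not [Z_n] alone, because the Markov property of Z is stated for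
    its own filtration. *)
Definition conditional_law_XZ n := forall A B, <<s sigmaZ n >> A -> measurable B ->
  Pr (A `&` rvX gam n @^-1` B) = (\int[Pr]_(w in A) Lam (rvZ gam n w) B)%E.

(** Integrate out [gam n] given the past, then [X_n] given [Z_1, ..., Z_n]; what remains is the
    left-hand side of [intertwining_integral] at z = [Z_n], which is almost surely positive. *)
Lemma integral_next n (A : set T) (F : R * R -> \bar R) : (1 <= n)%N ->
  conditional_law_XZ n -> <<s sigmaZ n >> A ->
  measurable_fun [set: R * R] F -> (forall p, 0 <= F p)%E ->
  (\int[Pr]_(w in A) F (rvX gam n.+1 w, rvZ gam n.+1 w) =
   \int[Pr]_(w in A) \int[kernelQ a lam (rvZ gam n w)]_y
      \int[Lam y]_t F (t, y))%E.
Proof.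
move=> n1 condn nA mF F0.
have mA : measurable A by exact: measurable_sigmaZ nA.
pose G (p : R * R * R) := F (p.1.1 * p.2, p.1.2 * p.2 + p.1.1^-1).
have mG : measurable_fun [set: R * R * R] G by exact: measurable_fun_step.
have G0 p : (0 <= G p)%E by exact: F0.
pose V w := (rvX gam n w, rvZ gam n w).
transitivity (\int[Pr]_(w in A) G (V w, gam n w))%E.
  by apply: eq_integral => w _; rewrite /G /V/= procXS procZS.
have mV : measurable_fun [set: g_sigma_algebraType (past_rectangles n)] V.
  apply: measurable_fun_pair; first exact: measurable_procX_past.
  exact: measurable_procZ_past.
apply: (etrans (integral_gam_past (sigmaZ_past nA) mV mG G0)).
(* The arguments are in the order (z, x), since the disintegration puts the conditioning variable
   first. *)
pose H (p : R * R) := (\int[Lam 1%R]_g G ((p.2, p.1), g))%E.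
have mH : measurable_fun [set: R * R] H.
  apply: (measurable_integral_Lam (u := fun=> 1)
    (F := fun p : R * R * R => G ((p.1.2, p.1.1), p.2))) => //.
  apply: (measurableT_comp (g := fun p : R * R * R => ((p.1.2, p.1.1), p.2)) mG).
  apply: measurable_fun_pair => //.
  by apply: measurable_fun_pair; exact: measurableT_comp.
have H0 p : (0 <= H p)%E by apply: integral_ge0.
apply: (etrans (@integral_conditional_law _ _ _ Pr _ _ _ (@Lambda_density_ge0 R a lam)
  (measurable_Lambda_density a lam) A (rvZ gam n) (rvZ gam n) (rvX gam n)
  mA _ _ _ _ H mH H0)).
- exact: measurable_funP.
- exact: measurable_funP.
- exact: measurable_funP.
- move=> C B mC mB; apply: condn => //.
  apply: (@measurableI _ (g_sigma_algebraType (sigmaZ n))) => //.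
  rewrite -[X in measurable X]setTI; apply: measurable_fun_generators => //=.
  by rewrite n1 leqnn.
- apply: (eq_integral_ae_pos (Z := rvZ gam n)).
  + exact: mA.
  + apply: (@measurable_integral_Lam _ _ (rvZ gam n)
      (fun p : T * R => H (rvZ gam n p.1, p.2))); last by move=> p; exact: H0.
      exact: measurable_funP.
    apply: (measurableT_comp (g := fun p : T * R => (rvZ gam n p.1, p.2)) mH).
    by apply: measurable_fun_pair => //; exact: measurableT_comp.
  + apply: (@measurable_integral_Q _ _ (rvZ gam n)
      (fun p : T * R => \int[Lam p.2]_t F (t, p.2))%E).
    * exact: measurable_funP.
    * apply: (@measurable_integral_Lam _ _ (fun p : T * R => p.2)
        (fun p : T * R * R => F (p.2, p.1.2))) => //.
        exact: measurable_snd.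
      apply: (measurableT_comp (g := fun p : T * R * R => (p.2, p.1.2)) mF).
      by apply: measurable_fun_pair => //; exact: measurableT_comp.
    * by move=> p; apply: integral_ge0.
  + by move=> w; apply: integral_ge0.
  + by move=> w; apply: integral_ge0 => y _; apply: integral_ge0.
  + exact: rvZ_ae_gt0.
  + by move=> w Zw; exact: (intertwining_integral lam a0 Zw mF F0).
Qed.

Let Lam_mass (y : R) (r : \bar R) : 0 < y -> (\int[Lam y]_t r = r)%E.
Proof.
move=> y0; apply: (etrans (integral_cst (Lam y) measurableT r)).
by rewrite kernelLambda_setT// mule1.
Qed.

(** [Z_1] is the constant 1, so its sigma-algebra is trivial and independent of [X_1 = gam 0], whose
    law is Lambda(1, .). *)
Lemma conditional_law_XZ1 : conditional_law_XZ 1.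
Proof.
move=> A B nA mB.
have nA0 : <<s past_rectangles 0 >> A.
  apply: (sub_generators _ nA) => k /=; rewrite -eqn_leq => /eqP <-.
  rewrite [X in measurable_fun _ X](_ : _ = cst 1); first exact: measurable_cst.
  by apply/funext => w; exact: procZ1.
transitivity (Pr (A `&` gam 0%N @^-1` B)).
  by congr (Pr (_ `&` _)); apply/funext => w; rewrite /preimage/= [rvX _ _ _]procX1.
rewrite (gam_indep_past nA0 mB) muleC.
apply: (etrans (esym (integral_cst Pr (measurable_sigmaZ nA) (Lam 1 B)))).
apply: eq_integral => w _; congr (Lam _ B).
by rewrite [RHS]procZ1.
Qed.

(** On an event [A'] of the past intersected with [Z_(n+1)] in [C], both sides are integrals over
    [A'] of functions of [(X_(n+1), Z_(n+1))], and [integral_next] sees such a function only through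
    its average under Lambda(y, .). *)
Lemma conditional_law_XZS n : (1 <= n)%N ->
  conditional_law_XZ n -> conditional_law_XZ n.+1.
Proof.
move=> n1 condn A B nA mB.
pose Z := rvZ gam n.+1; pose X := rvX gam n.+1.
have mpre (Y : {RV Pr >-> R}) C : measurable C -> measurable (Y @^-1` C).
  by move=> mC; rewrite -[X in measurable X]setTI; exact: measurable_funP.
(* Stable under intersection and rich enough to generate the new past: [A' = setT] gives the events
   of [Z_(n+1)], and [C = setT] those of the earlier [Z_k]. *)
pose E := [set A' `&` Z @^-1` C | A' in <<s sigmaZ n >> & C in @measurable _ R].
have mE : E `<=` measurable.
  move=> _ [A' nA' [C mC <-]]; apply: measurableI; last exact: mpre.
  exact: measurable_sigmaZ nA'.
have sT : <<s sigmaZ n >> setT.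
  exact: (@measurableT _ (g_sigma_algebraType (sigmaZ n))).
have EA : <<s E >> A.
  apply: (sub_generators _ nA) => k /= /andP[k1 kn].
  move=> _ C mC; rewrite setTI; apply: sub_sigma_algebra.
  move: kn; rewrite leq_eqVlt => /predU1P[->|kn].
    by exists setT => //; exists C => //; rewrite setTI.
  exists (rvZ gam k @^-1` C); last by exists setT => //; rewrite preimage_setT setIT.
  rewrite -[X in <<s _ >> X]setTI.
  by apply: measurable_fun_generators => //=; rewrite k1.
have mLB : measurable_fun [set: R] (fun y => Lam y B).
  exact: (measurable_kernel Lam).
have mh : measurable_fun [set: T] (fun w => Lam (Z w) B).
  exact: (measurableT_comp mLB).
have h0 w : (0 <= Lam (Z w) B)%E by exact: measure_ge0.
have mXB := mpre X _ mB.
apply: (@g_sigma_algebra_measure_unique _ _ _ E mE (fun=> setT) _ _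
  (mrestr Pr mXB) (density_measure Pr mh h0) _ _ _ A EA).
- by move=> _; exists setT => //; exists setT => //; rewrite preimage_setT setIT.
- exact: bigcup_const.
- move=> _ _ [A1 nA1 [C1 mC1 <-]] [A2 nA2 [C2 mC2 <-]].
  exists (A1 `&` A2).
    exact: (@measurableI _ (g_sigma_algebraType (sigmaZ n))).
  exists (C1 `&` C2); first exact: measurableI.
  by rewrite preimage_setI setIACA.
- move=> _ [A' nA' [C mC <-]].
  have mA' := measurable_sigmaZ nA'.
  (* For [y > 0], [F1] and [F2] have the same average under Lambda(y, .), namely the indicator of
     [C] at [y] times [Lam y B]. *)
  pose F1 (p : R * R) : \bar R := (\1_B p.1 * \1_C p.2)%:E.
  pose F2 (p : R * R) : \bar R := ((\1_C p.2)%:E * Lam p.2 B)%E.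
  have mF1 : measurable_fun [set: R * R] F1.
    apply/measurable_EFinP; apply: measurable_funM.
      exact: (measurableT_comp (@measurable_indic _ _ R setT B mB) measurable_fst).
    exact: (measurableT_comp (@measurable_indic _ _ R setT C mC) measurable_snd).
  have mF2 : measurable_fun [set: R * R] F2.
    apply: emeasurable_funM.
      apply/measurable_EFinP.
      exact: (measurableT_comp (@measurable_indic _ _ R setT C mC) measurable_snd).
    exact: (measurableT_comp mLB measurable_snd).
  have F10 p : (0 <= F1 p)%E by rewrite lee_fin mulr_ge0.
  have F20 p : (0 <= F2 p)%E by rewrite mule_ge0// lee_fin.
  transitivity (\int[Pr]_(w in A') F1 (X w, Z w))%E.
    transitivity (Pr ((Z @^-1` C `&` X @^-1` B) `&` A')).
      by rewrite [in RHS]setIC [in RHS]setIA.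
    rewrite -integral_indic//; last by apply: measurableI; exact: mpre.
    apply: eq_integral => w _; rewrite /F1; congr (_%:E).
    by rewrite indicI mulrC.
  apply: (etrans (integral_next n1 condn nA' mF1 F10)).
  transitivity (\int[Pr]_(w in A') F2 (X w, Z w))%E; last first.
    transitivity (\int[Pr]_(w in A' `&` Z @^-1` C) Lam (Z w) B)%E; last by [].
    rewrite integral_mkcondr; apply: eq_integral => w _.
    rewrite patchE /F2; case: ifPn => wC.
      by rewrite indicE (_ : _ \in C) ?mul1e// inE; move: wC; rewrite inE.
    rewrite indicE (_ : _ \in C = false) ?mul0e//; apply/negbTE.
    by apply: contra wC; rewrite !inE.
  apply: esym; apply: (etrans (integral_next n1 condn nA' mF2 F20)).
  apply: eq_integral => w _; apply: eq_integral_density_mkernel.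
  + apply: (@measurable_integral_Lam _ _ id (fun p : R * R => F2 (p.2, p.1)));
      [exact: measurable_id| |by move=> p; exact: F20].
    apply: (measurableT_comp (g := fun p : R * R => (p.2, p.1)) mF2).
    exact: measurable_fun_pair.
  + apply: (@measurable_integral_Lam _ _ id (fun p : R * R => F1 (p.2, p.1)));
      [exact: measurable_id| |by move=> p; exact: F10].
    apply: (measurableT_comp (g := fun p : R * R => (p.2, p.1)) mF1).
    exact: measurable_fun_pair.
  + by move=> y; apply: integral_ge0.
  + by move=> y; apply: integral_ge0.
  (* [F2] is constant in its first coordinate, where 0 is a mere placeholder, and [Lam y] has mass
     1. *)
  + move=> y y0; apply: (etrans (Lam_mass (F2 (0, y)) y0)).
    transitivity (\int[Lam y]_t ((\1_C y)%:E * (\1_B t)%:E))%E; last first.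
      by apply: eq_integral => t _; rewrite -EFinM mulrC.
    have mB1 : measurable_fun [set: R] (fun t => (\1_B t : R)%:E).
      exact/measurable_EFinP/measurable_indic.
    have B10 t : [set: R] t -> (0 <= (\1_B t : R)%:E)%E by rewrite lee_fin.
    have C0 : (0 <= (\1_C y : R)%:E)%E by rewrite lee_fin.
    rewrite (ge0_integralZl _ measurableT mB1 B10 C0).
    by rewrite integral_indic// setIT.
- by move=> _; rewrite /= /mrestr setTI (le_lt_trans (probability_le1 Pr mXB))// ltry.
Qed.

Lemma conditional_law_XZP n : (1 <= n)%N -> conditional_law_XZ n.
Proof.
case: n => // n _; elim: n => [|n IH]; first exact: conditional_law_XZ1.
exact: conditional_law_XZS.
Qed.


Lemma markov_chain_rvX : markov_chain_on (posreals R) (rvX gam) (kernelP a lam).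
Proof.
split.
- by apply: markov_density_mkernel => x; exact: kernelP_setT.
- move=> n _; apply: filterS (rvX_ae_gt0 n) => w Xw.
  by rewrite /= in_itv/= Xw.
move=> n n1 B mB.
pose G := generators [set i | (1 <= i <= n)%N] (rvX gam).
have mPB : measurable_fun [set: R] (fun x => kernelP a lam x B).
  exact: (measurable_kernel (kernelP a lam)).
split.
  apply: (measurableT_comp mPB); apply: measurable_fun_generators => /=.
  by rewrite n1 leqnn.
move=> A GA.
have nA : <<s past_rectangles n >> A.
  apply: sub_generators GA => k /= /andP[_ kn]; exact: measurable_procX_past.
have mA : measurable A.
  by apply: g_sigma_algebra_sub nA; exact: measurable_past_rectangles.
pose F (p : R * R) : \bar R := (\1_B (p.1 * p.2))%:E.
have mF : measurable_fun [set: R * R] F.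
  apply/measurable_EFinP.
  apply: (measurableT_comp (@measurable_indic _ _ R setT B mB)).
  exact: measurable_funM.
have F0 p : (0 <= F p)%E by rewrite lee_fin.
transitivity (\int[Pr]_(w in A) F (rvX gam n w, gam n w))%E.
  rewrite setIC -integral_indic//; last first.
    by rewrite -[X in measurable X]setTI; exact: measurable_funP.
  by apply: eq_integral => w _; congr (_%:E); rewrite /F/= -procXS.
have mX : measurable_fun [set: g_sigma_algebraType (past_rectangles n)] (rvX gam n).
  exact: measurable_procX_past.
apply: (etrans (integral_gam_past nA mX mF F0)).
apply: (eq_integral_ae_pos (Z := rvX gam n)).
- exact: mA.
- apply: (@measurable_integral_Lam _ _ (fun _ : T => 1)
    (fun p : T * R => F (rvX gam n p.1, p.2))).
  + exact: measurable_cst.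
  + apply: (measurableT_comp (g := fun p : T * R => (rvX gam n p.1, p.2)) mF).
    by apply: measurable_fun_pair => //; exact: measurableT_comp.
  + by move=> p; exact: F0.
- by apply: (measurableT_comp mPB); exact: measurable_funP.
- by move=> w; apply: integral_ge0.
- by move=> w; exact: measure_ge0.
- exact: rvX_ae_gt0.
- by move=> w Xw; rewrite kernelP_scale.
Qed.

(** In [integral_next], a function of the second coordinate alone is unchanged by averaging under
    Lambda(y, .), and only the kernel Q remains. *)
Lemma markov_chain_rvZ : markov_chain_on (posreals R) (rvZ gam) (kernelQ a lam).
Proof.
split.
- by apply: markov_density_mkernel => x; exact: kernelQ_setT.
- move=> n n1; apply: filterS (rvZ_ae_gt0 n1) => w Zw.
  by rewrite /= in_itv/= Zw.
move=> n n1 B mB.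
have mQB : measurable_fun [set: R] (fun x => kernelQ a lam x B).
  exact: (measurable_kernel (kernelQ a lam)).
split.
  apply: (measurableT_comp mQB); apply: measurable_fun_generators => /=.
  by rewrite n1 leqnn.
move=> A nA.
have mA := measurable_sigmaZ nA.
have mIB : measurable_fun [set: R] (fun t => (\1_B t : R)%:E).
  exact/measurable_EFinP/measurable_indic.
pose F (p : R * R) : \bar R := (\1_B p.2)%:E.
have mF : measurable_fun [set: R * R] F by exact: (measurableT_comp mIB measurable_snd).
have F0 p : (0 <= F p)%E by rewrite lee_fin.
transitivity (\int[Pr]_(w in A) F (rvX gam n.+1 w, rvZ gam n.+1 w))%E.
  rewrite setIC -integral_indic//.
  by rewrite -[X in measurable X]setTI; exact: measurable_funP.
have condn : conditional_law_XZ n by exact: conditional_law_XZP.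
apply: (etrans (integral_next n1 condn nA mF F0)).
apply: eq_integral => w _.
transitivity (\int[kernelQ a lam (rvZ gam n w)]_y (\1_B y)%:E)%E; last first.
  by rewrite integral_indic// setIT.
apply: eq_integral_density_mkernel => //.
- apply: (@measurable_integral_Lam _ _ id (fun p : R * R => F (p.2, p.1))) => //.
  by apply: (measurableT_comp mIB); exact: measurable_fst.
- by move=> y; apply: integral_ge0.
- by move=> y y0; exact: (Lam_mass (F (0, y)) y0).
Qed.

(** The sigma-algebra of [Z_n] lies in that of [Z_1, ..., Z_n], and the conditional law given the
    latter is already a function of [Z_n]. *)
Lemma conditional_law_rvX n : (1 <= n)%N ->
  conditional_law (generators [set n] (rvZ gam)) (rvX gam n)
    (fun w => kernelLambda a lam (rvZ gam n w)).
Proof.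
move=> n1 B mB; split.
  apply: (measurableT_comp (measurable_kernel (kernelLambda a lam) B mB)).
  exact: measurable_fun_generators.
move=> A nA.
apply: (conditional_law_XZP n1) => //.
apply: sub_generators nA => k -> /=.
by apply: measurable_fun_generators => /=; rewrite n1 leqnn.
Qed.

End gig_chain.

Theorem proposition3p5 (R : realType) (d : measure_display)
    (T : measurableType d) (Pr : probability T R)
    (a lam : R) (gam : nat -> {RV Pr >-> R}) :
  0 < a ->
  mutually_independent gam ->
  (forall (n : nat) (A : set R), measurable A ->
     distribution Pr (gam n) A = gig_law lam a A) ->
  [/\ markov_chain_on (posreals R) (rvX gam) (kernelP a lam),
      markov_chain_on (posreals R) (rvZ gam) (kernelQ a lam),
      forall n : nat, (1 <= n)%N ->
        conditional_law (generators [set n] (rvZ gam)) (rvX gam n)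
          (fun w => kernelLambda a lam (rvZ gam n w)) &
      intertwines (posreals R)
        (kernelLambda a lam) (kernelP a lam) (kernelQ a lam)].
Proof.
move=> a0 gam_indep gam_law; split.
- exact: markov_chain_rvX.
- exact: markov_chain_rvZ.
- by move=> n n1; exact: conditional_law_rvX.
- exact: intertwines_kernelLambda.
Qed.
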